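(* Let $0<\ell\le1$, $T>0$, $u_0\in L^2(0,\ell)$, $u_0\neq0$, and let $\alpha_1,\alpha_2\in[0,2)$. For $i=1,2$ let $u_i$ be the solution of the degenerate problem with power $\alpha_i$ (described in the context). If for some $t_0\in(0,T]$ we have $\partial_t u_1(x,t_0)=\partial_t u_2(x,t_0)$ and $\partial_x u_1(x,t_0)=\partial_x u_2(x,t_0)$ for all $x\in(0,\ell)$, then $\alpha_1=\alpha_2$.
   Context: For $\alpha\in[0,2)$, the degenerate problem with power $\alpha$ is $\partial_t u-\partial_x(x^\alpha\partial_x u)=0$ in $(0,\ell)\times(0,T)$, $u(x,0)=u_0(x)$, with boundary conditions $u(0,t)=u(\ell,t)=0$ if $0\le\alpha<1$ (weak degeneracy), and $x^\alpha\partial_x u(x,t)|_{x=0}=0$, $u(\ell,t)=0$ if $1\le\alpha<2$ (strong degeneracy). Its solution is $u(t)=e^{tA}u_0$, where $Au=\partial_x(x^\alpha\partial_xu)$ with domain $\{u\in H^1_\alpha(0,\ell): x^\alpha\partial_x u\in H^1(0,\ell)\}$ generates an analytic contraction semigroup on $L^2(0,\ell)$; here $H^1_\alpha(0,\ell)=\{u\in L^2:\int_0^\ell x^\alpha|\partial_xu|^2<\infty,\ u(0)=u(\ell)=0\}$ for $\alpha<1$ and $\{u\in L^2:\int_0^\ell x^\alpha|\partial_xu|^2<\infty,\ u(\ell)=0\}$ for $1\le\alpha<2$. *)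

(* Defs.v *)
From HB Require Import structures.
From mathcomp Require Import all_boot all_order all_algebra.
From mathcomp Require Import all_classical all_reals all_analysis.
Set Implicit Arguments. Unset Strict Implicit. Unset Printing Implicit Defensive.
Import Order.TTheory GRing.Theory Num.Theory.
Import numFieldNormedType.Exports.
Local Open Scope classical_set_scope.
Local Open Scope ring_scope.

Section Defs.
Variable R : realType.
Local Notation mu := (@lebesgue_measure R).

Definition Iol (l : R) : set R := `]0, l[.

Definition isL2 (l : R) (f : R -> R) : Prop :=
  measurable_fun (Iol l) f /\
  (\int[mu]_(x in Iol l) ((f x) ^+ 2)%:E < +oo)%E.

Definition L2dist2 (l : R) (f g : R -> R) : \bar R :=
  \int[mu]_(x in Iol l) ((f x - g x) ^+ 2)%:E.

Definition ae_eq_on (l : R) (f g : R -> R) : Prop :=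
  {ae mu, forall x, Iol l x -> f x = g x}.

Definition test_fun (l : R) (phi : R -> R) : Prop :=
  (forall (n : nat) (x : R), derivable (derive1n n phi) x 1) /\
  exists a b : R, [/\ 0 < a, a < b, b < l &
    forall x, ~ `[a, b]%classic x -> phi x = 0].

Definition L1loc (l : R) (g : R -> R) : Prop :=
  measurable_fun (Iol l) g /\
  forall a b : R, 0 < a -> a < b -> b < l -> mu.-integrable `[a, b]%classic (EFin \o g).

Definition weak_deriv (l : R) (f g : R -> R) : Prop :=
  L1loc l f /\ L1loc l g /\
  forall phi, test_fun l phi ->
    Rintegral mu (Iol l) (fun x => f x * derive1 phi x) =
    - Rintegral mu (Iol l) (fun x => g x * phi x).

(* H^1_alpha(0,l) with the boundary conditions of the context:
   u(0)=u(l)=0 if alpha < 1, u(l)=0 if 1 <= alpha < 2; boundary values are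
   those of the continuous representative of u on (0,l). *)
Definition H1_alpha (l alpha : R) (u : R -> R) : Prop :=
  isL2 l u /\
  (exists g, weak_deriv l u g /\
     (\int[mu]_(x in Iol l) ((x `^ alpha) * (g x) ^+ 2)%:E < +oo)%E) /\
  exists uc : R -> R,
    [/\ {in Iol l, continuous uc}, ae_eq_on l u uc,
        uc x @[x --> l^'-] --> 0 &
        alpha < 1 -> uc x @[x --> 0^'+] --> 0].

Definition isH1 (l : R) (v : R -> R) : Prop :=
  isL2 l v /\ exists g, weak_deriv l v g /\ isL2 l g.

(* graph of the operator A u = (x^alpha u_x)_x with domain
   { u in H^1_alpha : x^alpha u_x in H^1 } *)
Definition A_op (l alpha : R) (u w : R -> R) : Prop :=
  H1_alpha l alpha u /\
  exists g, [/\ weak_deriv l u g,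
               isH1 l (fun x => x `^ alpha * g x),
               weak_deriv l (fun x => x `^ alpha * g x) w & isL2 l w].

(* v is the L^2(0,l)-valued derivative of t |-> u t at t (t in (0,T]),
   taken within (0,T] (one-sided at t = T) *)
Definition time_deriv (l T : R) (u : R -> R -> R) (t : R) (v : R -> R) : Prop :=
  isL2 l v /\
  forall e : R, 0 < e -> exists2 d : R, 0 < d & forall h : R,
    h != 0 -> `|h| < d -> 0 < t + h -> t + h <= T ->
    (L2dist2 l (fun x => ((u (t + h) x - u t x) / h)%R) v < e%:E)%E.

(* u (u t x = u(x,t)) is the solution u(t) = e^{tA} u0 on (0,T]:
   the (unique) strong solution of u' = A u in L^2(0,l), u(t) -> u0 as t -> 0+ *)
Definition is_solution (l T alpha : R) (u0 : R -> R) (u : R -> R -> R) : Prop :=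
  (forall t, 0 < t -> t <= T ->
     exists w, A_op l alpha (u t) w /\ time_deriv l T u t w) /\
  (forall e : R, 0 < e -> exists2 d : R, 0 < d & forall t : R,
     0 < t -> t < d -> t <= T -> (L2dist2 l (u t) u0 < e%:E)%E).

End Defs.

(* Main.v *)
Require Import Defs.
From HB Require Import structures.
From mathcomp Require Import all_boot all_order all_algebra.
From mathcomp Require Import all_classical all_reals all_analysis.
From mathcomp Require Import measurable_realfun.
From mathcomp Require Import ring lra.
Import Order.TTheory GRing.Theory Num.Theory.
Import numFieldNormedType.Exports.
Set Implicit Arguments.
Unset Strict Implicit.
Unset Printing Implicit Defensive.
Local Open Scope classical_set_scope.
Local Open Scope ring_scope.

(** Suppose a1 < a2 and let g be the common space derivative at time t0. The fluxes
    x^a1 g and x^a2 g have the same derivative, so (x^a1 - x^a2) g is a constant c and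
    g has the sign of c. If a1 < 1, then u1(t0) is monotone and vanishes at both ends,
    hence it is 0. If a1 >= 1, then x^a1 g^2 >= c^2 / x, so finite energy forces c = 0
    and again u1(t0) = 0, because it vanishes at l.

    The operator is symmetric, since the Wronskian x^a (u' v - u v') tends to 0 at both
    ends. Hence <u(t), u(s - t)> does not depend on t, which gives
    |u((r + t0) / 2)|^2 = <u(t0), u(r)> = 0 for 0 < r < t0. Iterating, u1 vanishes at
    times tending to 0, and u0 = 0.

    A function with a weak derivative g is, at its Lebesgue points, a primitive of g: test
    against smooth approximations of the indicator of [a, b]. *)

(** * A smooth step function *)

(** The hypothesis l <= 1 enters through two inequalities on (0, l): x^a2 < x^a1 for a1 < a2, which
    fixes the sign of g, and x^a <= x for a >= 1, which turns a lower bound on the flux into an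
    energy density above a constant over x.

    The delicate point is the Wronskian at 0 when a >= 1: no value of u is prescribed there and only
    u in L^2 is available. The flux is O(sqrt x) at 0, so if the Wronskian stayed above some e > 0
    near 0, then u^2 + v^2 would exceed a constant over x, which is not integrable. This gives
    points arbitrarily close to 0 where the Wronskian is small, and such points are all that the
    symmetry of the operator requires.

    Backward uniqueness is obtained without spectral theory or analyticity in time: the pairing
    argument uses only the L^2 derivative in t and the symmetry. Taking r = s / 2 in the midpoint
    identity passes from a zero at time s to a zero at time 3s / 4. *)

Section smooth_step.
Context {R : realType}.
Implicit Types f g : R -> R.

(** Recursing on the derivative makes closure under sums, products, inverses and affine substitution
    a plain induction; [smoothn_derive1n] translates back to the form that [test_fun] asks for. *)
Fixpoint smoothn (n : nat) f : Prop :=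
  if n is m.+1 then (forall x, derivable f x 1) /\ smoothn m (derive1 f) else True.

Lemma smoothnW n f : smoothn n.+1 f -> smoothn n f.
Proof.
by elim: n f => //= n IH f [df [df' sf]]; split => //; apply: IH.
Qed.

Lemma smoothn_derive1n n f : smoothn n.+1 f -> forall x, derivable (derive1n n f) x 1.
Proof.
elim: n f => [|n IH] f /= [df sf] //.
by move=> x; have := IH _ sf x; rewrite -derive1nS /derive1n iterSr.
Qed.

Lemma smoothnD n f g : smoothn n f -> smoothn n g -> smoothn n (fun x => f x + g x).
Proof.
elim: n f g => //= n IH f g [df sf] [dg sg]; split=> [x|]; first exact: derivableD.
rewrite (_ : derive1 _ = (fun x => derive1 f x + derive1 g x)); first exact: IH.
by apply/funext => x; rewrite !derive1E deriveD.
Qed.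

Lemma smoothn_cst n (c : R) : smoothn n (fun=> c).
Proof.
elim: n c => //= n IH c; split => [x|]; first exact: derivable_cst.
by rewrite (_ : derive1 _ = fun=> 0)//; apply/funext => x; rewrite derive1_cst.
Qed.

Lemma smoothnM n f g : smoothn n f -> smoothn n g -> smoothn n (fun x => f x * g x).
Proof.
elim: n f g => //= n IH f g [df sf] [dg sg]; split=> [x|]; first exact: derivableM.
rewrite (_ : derive1 _ = (fun x => f x * derive1 g x + g x * derive1 f x)).
  apply: smoothnD; apply: IH => //; exact: smoothnW.
by apply/funext => x; rewrite !derive1E deriveM.
Qed.

Lemma is_derive_affine f (a b x : R) : derivable f (a * x + b) 1 ->
  is_derive x 1 (fun x : R => f (a * x + b)) (a * derive1 f (a * x + b)).
Proof.
move=> df; have h1 : is_derive (a * x + b) 1 f (derive1 f (a * x + b)).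
  by rewrite derive1E; apply/derivableP.
have h2 : is_derive x 1 (fun x => a * x + b) a.
  by apply: is_derive_eq; rewrite addr0 /GRing.scale/= mulr1.
have := @is_derive1_comp _ f (fun x => a * x + b) x _ _ h1 h2.
by rewrite /GRing.scale /= mulrC.
Qed.

Lemma smoothn_affine n f (a b : R) : smoothn n f -> smoothn n (fun x => f (a * x + b)).
Proof.
elim: n f => //= n IH f [df sf].
have H (x : R) := is_derive_affine (df (a * x + b)).
split=> [x|]; first by case: (H x).
rewrite (_ : derive1 _ = (fun x => a * derive1 f (a * x + b))).
  by apply: smoothnM; [exact: smoothn_cst|exact: IH].
by apply/funext => x; rewrite derive1E; case: (H x).
Qed.

Lemma smoothnV n f : (forall x, f x != 0) -> smoothn n f -> smoothn n (fun x => (f x)^-1).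
Proof.
move=> f0; elim: n => //= n IH [df sf]; split => [x|]; first exact: derivableV.
rewrite (_ : derive1 _ = (fun x => (-1) * ((f x)^-1 * (f x)^-1 * derive1 f x))).
  apply: smoothnM; first exact: smoothn_cst.
  have : smoothn n.+1 f by [].
  move=> /smoothnW/IH ?; apply: smoothnM => //; exact: smoothnM.
apply/funext => x; rewrite !derive1E deriveV// /GRing.scale/= mulN1r.
by rewrite -exprVn expr2 mulNr.
Qed.

(** The powers of 1/x accompany exp(-1/x) so that the linear span of the family is stable under
    differentiation; smoothness of [flat 0] is then one induction over all n at once. *)
Definition flat (n : nat) (x : R) : R :=
  if 0 < x then x^-1 ^+ n * expR (- x^-1) else 0.

(** With y = 1/x this is exp y >= y^(n+2) / (n+2)!, one term of the exponential series. The exponent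
    2 is what makes the difference quotient at 0 tend to 0. *)
Lemma flat_le_sqr n x : `|flat n x| <= (n.+2)`!%:R * x ^+ 2.
Proof.
rewrite /flat; case: ifPn => x0; last by rewrite normr0 mulr_ge0// sqr_ge0.
have y0 : 0 < x^-1 by rewrite invr_gt0.
rewrite ger0_norm; last by rewrite mulr_ge0 ?expR_ge0// exprn_ge0// ltW.
rewrite -[x in leRHS]invrK; move: (x^-1) y0 => y y0.
have := expR_ge1Dxn n.+1 (ltW y0) => h.
have {}h : y ^+ n.+2 / (n.+2)`!%:R <= expR y by lra.
rewrite expRN ler_pdivrMr ?expR_gt0//.
rewrite exprVn.
have f0 : (0 : R) < (n.+2)`!%:R by rewrite ltr0n fact_gt0.
rewrite ler_pdivrMr// in h.
have -> : (n.+2)`!%:R / y ^+ 2 * expR y = (expR y * (n.+2)`!%:R) / y ^+ 2 by ring.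
rewrite ler_pdivlMr ?exprn_gt0//.
by rewrite -exprD addn2.
Qed.

Lemma is_derive_flat n (x : R) :
  is_derive x 1 (flat n) ((- n%:R) * flat n.+1 x + flat n.+2 x).
Proof.
have [x0|x0|->] := ltgtP x 0.
- rewrite /flat !ltNge !(ltW x0)/= mulr0 addr0.
  apply: (@near_eq_is_derive _ _ _ (cst 0)).
    by near=> y; rewrite lt_gtF//; near: y; apply: lt_nbhsl.
- have -> : - n%:R * flat n.+1 x + flat n.+2 x =
      x^-1 ^+ n.+2 * expR (- x^-1) - n%:R * x^-1 ^+ n.+1 * expR (- x^-1).
    by rewrite /flat x0; ring.
  apply: (@near_eq_is_derive _ _ _ (fun y : R => y^-1 ^+ n * expR (- y^-1))).
    by near=> y; rewrite /flat ifT//; near: y; apply: lt_nbhsr.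
  have hV : is_derive x 1 (fun y : R => y^-1) (- x^-1 ^+ 2).
    have := @is_deriveV _ id x 1 1 (lt0r_neq0 x0) (is_derive_id _ _).
    by rewrite /GRing.scale/= mulr1 exprVn.
  have hN : is_derive x 1 (fun y : R => expR (- y^-1)) (x^-1 ^+ 2 * expR (- x^-1)).
    have h1 := @is_deriveN _ _ _ _ _ _ _ hV.
    have := @is_derive1_comp _ expR (fun y => - y^-1) x _ _ (is_derive_expR _) h1.
    by rewrite opprK mulrC.
  have hX := @is_deriveX _ _ _ n _ _ _ hV.
  have hM := @is_deriveM _ _ _ _ _ _ _ _ hX hN.
  rewrite (_ : (fun y : R => _) =
      (fun y : R => y^-1) ^+ n * (fun y : R => expR (- y^-1))); last first.
    by apply/funext => y; rewrite !fctE.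
  apply: (is_derive_eq hM); rewrite !fctE /GRing.scale/=.
  by case: n {hX hM} => [|n] /=; rewrite !exprS; ring.
- have -> : - n%:R * flat n.+1 0 + flat n.+2 0 = 0 by rewrite /flat ltxx; ring.
  suff H : h^-1 *: (flat n (h + 0) - flat n 0) @[h --> (0:R)^'] --> (0:R).
    apply: DeriveDef.
      apply/cvg_ex; exists 0 => /=; move: H.
      by under eq_fun do rewrite -[X in flat n (X + _)]mulr1.
    apply/cvg_lim => //; move: H.
    by under eq_fun do rewrite -[X in flat n (X + _)]mulr1.
  apply/cvgrPdist_le => e e0; near=> h.
  rewrite sub0r normrN addr0 [in flat n 0]/flat ltxx subr0.
  have h0 : h != 0 by near: h; exact: nbhs_dnbhs_neq.
  rewrite /GRing.scale/= normrM normfV mulrC ler_pdivrMr ?normr_gt0//.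
  apply: le_trans (flat_le_sqr _ _) _.
  rewrite -real_normK ?num_real// expr2 mulrA ler_wpM2r//.
  have f0 : (0 : R) < (n.+2)`!%:R by rewrite ltr0n fact_gt0.
  rewrite mulrC -ler_pdivlMr//; near: h.
  by apply: dnbhs0_le; rewrite divr_gt0.
Unshelve. all: by end_near. Qed.

Lemma smoothn_flat k n : smoothn k (flat n).
Proof.
elim: k n => //= k IH n; split => [x|]; first by case: (is_derive_flat n x).
rewrite (_ : derive1 _ = fun x => (- n%:R) * flat n.+1 x + flat n.+2 x).
  by apply: smoothnD => //; apply: smoothnM => //; exact: smoothn_cst.
by apply/funext => x; rewrite derive1E; case: (is_derive_flat n x).
Qed.

Lemma flat0_ge0 x : 0 <= flat 0 x.
Proof. by rewrite /flat; case: ifP => // _; rewrite expr0 mul1r expR_ge0. Qed.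

Lemma flat0_gt0 x : 0 < x -> 0 < flat 0 x.
Proof. by move=> x0; rewrite /flat x0 expr0 mul1r expR_gt0. Qed.

Lemma flat0_le0 x : x <= 0 -> flat 0 x = 0.
Proof. by move=> x0; rewrite /flat ltNge x0. Qed.

(** The classical quotient phi(x) / (phi(x) + phi(1 - x)); [1 - x] is spelled as an affine map to
    fit [smoothn_affine]. *)
Definition smooth_step (x : R) : R := flat 0 x * (flat 0 x + flat 0 ((-1) * x + 1))^-1.

Lemma smooth_step_denom_gt0 x : 0 < flat 0 x + flat 0 ((-1) * x + 1).
Proof.
have [x0|x0] := ltP 0 x; first by rewrite ltr_pwDl ?flat0_gt0 ?flat0_ge0.
by rewrite ltr_wpDl ?flat0_ge0// flat0_gt0//; lra.
Qed.

Lemma smooth_step0 x : x <= 0 -> smooth_step x = 0.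
Proof. by move=> x0; rewrite /smooth_step flat0_le0// mul0r. Qed.

Lemma smooth_step1 x : 1 <= x -> smooth_step x = 1.
Proof.
move=> x1; rewrite /smooth_step [flat 0 (_ + _)]flat0_le0; last by lra.
by rewrite addr0 divff// gt_eqF// flat0_gt0//; lra.
Qed.

Lemma smooth_step_ge0 x : 0 <= smooth_step x.
Proof. by rewrite divr_ge0 ?flat0_ge0// ltW// smooth_step_denom_gt0. Qed.

Lemma smooth_step_le1 x : smooth_step x <= 1.
Proof.
by rewrite ler_pdivrMr ?smooth_step_denom_gt0// mul1r lerDl flat0_ge0.
Qed.

Lemma smoothn_smooth_step n : smoothn n smooth_step.
Proof.
apply: smoothnM; first exact: smoothn_flat.
apply: smoothnV; first by move=> x; rewrite gt_eqF// smooth_step_denom_gt0.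
by apply: smoothnD; [|apply: smoothn_affine]; exact: smoothn_flat.
Qed.

Lemma derivable_smooth_step x : derivable smooth_step x 1.
Proof. by have [] := smoothn_smooth_step 1. Qed.

Lemma continuous_derive1_smooth_step : continuous (derive1 smooth_step).
Proof.
move=> x; apply: differentiable_continuous; apply/derivable1_diffP.
by have [_ []] := smoothn_smooth_step 2.
Qed.

Lemma derive1_smooth_step_out x : ~ `[0, 1]%classic x -> derive1 smooth_step x = 0.
Proof.
move=> /=; rewrite in_itv/= => /negP; rewrite negb_and -!ltNge derive1E => /orP[x0|x1].
- rewrite (@near_eq_derive _ _ _ smooth_step (cst 0)) ?derive_cst//.
  by near=> y; rewrite smooth_step0// ltW//; near: y; exact: lt_nbhsl.
- rewrite (@near_eq_derive _ _ _ smooth_step (cst 1)) ?derive_cst//.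
  by near=> y; rewrite smooth_step1// ltW//; near: y; exact: lt_nbhsr.
Unshelve. all: by end_near. Qed.

Lemma derive1_smooth_step_bounded : exists2 M, 0 < M & forall x, `|derive1 smooth_step x| <= M.
Proof.
have c : {within `[0, 1], continuous (fun x => `|derive1 smooth_step x|)}.
  apply: continuous_subspaceT => x; apply: (@continuous_comp _ _ _ (derive1 smooth_step)).
    exact: continuous_derive1_smooth_step.
  exact: norm_continuous.
have [c0 _ Hc] := EVT_max (@ler01 R) c.
(* Adding 1 makes the bound positive without examining the maximum. *)
exists (`|derive1 smooth_step c0| + 1); first by rewrite ltr_wpDl.
move=> x; have [/Hc h|h] := boolP (x \in `[0, 1]); first by rewrite (le_trans h)// lerDl.
by rewrite derive1_smooth_step_out ?normr0 ?addr_ge0//; apply/negP.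
Qed.

End smooth_step.

(** * Primitives of locally integrable functions *)

Section real_integral.
Context {R : realType}.
Local Notation mu := (@lebesgue_measure R).
Implicit Types (f g h : R -> R) (A : set R).

Lemma integrable_EFinD A f g : measurable A -> mu.-integrable A (EFin \o f) ->
  mu.-integrable A (EFin \o g) -> mu.-integrable A (EFin \o (fun x => f x + g x)).
Proof. by move=> mA fi gi; apply: (integrableD _ fi gi). Qed.

Lemma integrable_EFinB A f g : measurable A -> mu.-integrable A (EFin \o f) ->
  mu.-integrable A (EFin \o g) -> mu.-integrable A (EFin \o (fun x => f x - g x)).
Proof. by move=> mA fi gi; apply: (integrableB _ fi gi). Qed.

Lemma integrable_EFinZ A f (c : R) : measurable A -> mu.-integrable A (EFin \o f) ->
  mu.-integrable A (EFin \o (fun x => c * f x)).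
Proof. by move=> mA fi; apply: (integrableZl _ c fi). Qed.

Lemma integrable_le A f g : measurable A -> measurable_fun A f ->
  (forall x, A x -> `|f x| <= g x) -> mu.-integrable A (EFin \o g) ->
  mu.-integrable A (EFin \o f).
Proof.
move=> mA mf fg; apply: le_integrable => //; first exact/measurable_EFinP.
by move=> x Ax /=; rewrite lee_fin (le_trans (fg _ Ax))// ler_norm.
Qed.

Lemma integrable_measurable A f : mu.-integrable A (EFin \o f) -> measurable_fun A f.
Proof. by move=> /(measurable_int mu)/measurable_EFinP. Qed.

Lemma integrable_bounded_mul A f h (M : R) : measurable A -> measurable_fun A h ->
  (forall x, A x -> `|h x| <= M) -> mu.-integrable A (EFin \o f) ->
  mu.-integrable A (EFin \o (fun x => h x * f x)).
Proof.
move=> mA mh hM fi; apply: (@integrable_le _ _ (fun x => M * `|f x|)) => //.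
- by apply: measurable_funM => //; exact: integrable_measurable.
- by move=> x Ax; rewrite normrM ler_wpM2r// hM.
- by apply: integrable_EFinZ => //; exact: integrable_norm.
Qed.

Lemma integrable_mul_bounded A f h (M : R) : measurable A -> measurable_fun A h ->
  (forall x, A x -> `|h x| <= M) -> mu.-integrable A (EFin \o f) ->
  mu.-integrable A (EFin \o (fun x => f x * h x)).
Proof.
move=> mA mh hM fi; rewrite (_ : (fun x => f x * h x) = fun x => h x * f x).
  exact: integrable_bounded_mul hM fi.
by apply/funext => x; rewrite mulrC.
Qed.

Lemma integrable_itv_cst (a b c : R) : mu.-integrable `[a, b] (EFin \o (fun=> c)).
Proof.
apply: continuous_compact_integrable; first exact: segment_compact.
by apply: continuous_subspaceT => x; exact: cvg_cst.
Qed.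

Lemma integrable_subitv (a b x y : R) f : a <= x -> y <= b ->
  mu.-integrable `[a, b] (EFin \o f) -> mu.-integrable `[x, y] (EFin \o f).
Proof.
move=> ax yb; apply: integrableS => //.
by apply: subset_itv; rewrite bnd_simp.
Qed.

Lemma Rintegral_split (a b c : R) f : a <= c -> c <= b ->
  mu.-integrable `[a, b] (EFin \o f) ->
  \int[mu]_(x in `[a, b]) f x = \int[mu]_(x in `[a, c]) f x + \int[mu]_(x in `[c, b]) f x.
Proof.
move=> ac cb fi; have := @Rintegral_itvB _ f (BLeft a) (BRight b) c fi.
rewrite !bnd_simp => /(_ ac cb) h.
rewrite -(@Rintegral_itv_obnd_cbnd _ c (BRight b)) -?h; first by rewrite addrC subrK.
apply: integrableS fi => //.
by apply: subset_itv; rewrite bnd_simp.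
Qed.

Lemma Rintegral_itv_cst (a b c : R) : a <= b -> \int[mu]_(x in `[a, b]) c = c * (b - a).
Proof.
move=> ab; rewrite Rintegral_cst//=; congr *%R; rewrite lebesgue_measure_itv/= lte_fin.
by case: ltgtP ab => //= -> _; rewrite subrr.
Qed.

Lemma ae_imply (P Q : R -> Prop) : {ae mu, forall x, P x} -> (forall x, P x -> Q x) ->
  {ae mu, forall x, Q x}.
Proof. by move=> [N [mN N0 sub]] PQ; exists N; split => // x nQ; apply: sub => /PQ. Qed.

Lemma ae_imply2 (P1 P2 Q : R -> Prop) :
  {ae mu, forall x, P1 x} -> {ae mu, forall x, P2 x} ->
  (forall x, P1 x -> P2 x -> Q x) -> {ae mu, forall x, Q x}.
Proof.
move=> [N1 [mN1 N10 sub1]] [N2 [mN2 N20 sub2]] PQ; exists (N1 `|` N2); split.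
- exact: measurableU.
- by rewrite null_set_setU.
- move=> x nQ; apply: contrapT => /= /not_orP[n1 n2]; apply: nQ; apply: PQ.
  + by apply: contrapT => h; apply: n1; exact: sub1.
  + by apply: contrapT => h; apply: n2; exact: sub2.
Qed.

Lemma Rintegral_ae_eq A f g : measurable A -> measurable_fun A f -> measurable_fun A g ->
  {ae mu, forall x, A x -> f x = g x} -> \int[mu]_(x in A) f x = \int[mu]_(x in A) g x.
Proof.
move=> mA mf mg fg; congr fine; apply: ae_eq_integral => //; [exact/measurable_EFinP..|].
by apply: (ae_imply fg) => x h Ax; rewrite h.
Qed.

Lemma le0_of_le_eps (x I : R) : 0 <= I -> (forall e : R, 0 < e -> x <= e * I) -> x <= 0.
Proof.
move=> I0 H; apply/ler_addgt0Pl => e e0; rewrite addr0.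
have I1 : 0 < I + 1 by lra.
apply: le_trans (H (e / (I + 1)) (divr_gt0 e0 I1)) _.
by rewrite mulrAC ler_pdivrMr// ler_wpM2l ?ltW//; lra.
Qed.

(* Cousin-type argument: the estimate propagates from the left end to the supremum of
   the points it reaches, which must therefore be the right end. *)
Lemma increment_le_of_local (F m : R -> R) (a b : R) : a <= b ->
  (forall x y : R, a <= x -> x <= y -> y <= b -> m x <= m y) ->
  (forall x : R, a <= x -> x <= b -> exists2 d : R, 0 < d & forall y : R, a <= y -> y <= b ->
     `|y - x| < d -> `|F y - F x| <= `|m y - m x|) ->
  `|F b - F a| <= m b - m a.
Proof.
move=> ab mono loc.
pose S := [set x | [/\ a <= x, x <= b & `|F x - F a| <= m x - m a]].
have Sa : S a by split => //; rewrite !subrr normr0.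
have Sub : has_sup S by split; [exists a | exists b => x []].
have aS : a <= sup S by apply: ub_le_sup => //; case: Sub.
have Sb : sup S <= b by apply: ge_sup; [exists a|move=> x []].
have [d d0 Hd] := loc _ aS Sb.
have [x [ax xb Fx] xS] := sup_adherent d0 Sub.
have xleS : x <= sup S by apply: ub_le_sup => //; case: Sub.
have SS : S (sup S).
  split => //.
  have h1 : `|F x - F (sup S)| <= `|m x - m (sup S)|.
    apply: Hd => //; rewrite ler0_norm; lra.
  have h2 := mono _ _ ax xleS Sb.
  have h3 : `|F (sup S) - F a| <= `|F x - F a| + `|F x - F (sup S)|.
    by have := ler_distD (F x) (F (sup S)) (F a); rewrite (distrC (F (sup S)) (F x)); lra.
  rewrite [in X in _ <= X]ler0_norm in h1; lra.
suff -> : b = sup S by case: SS.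
apply/eqP; rewrite eq_le Sb andbT leNgt; apply/negP => Sltb.
pose y := Order.min b (sup S + d / 2).
have Sy : sup S < y by rewrite lt_min Sltb/=; lra.
have yb : y <= b by rewrite ge_min lexx.
have yd : y <= sup S + d / 2 by rewrite ge_min lexx orbT.
have : S y.
  split => //; first lra.
  have h1 : `|F y - F (sup S)| <= `|m y - m (sup S)|.
    by apply: Hd => //; [lra|rewrite gtr0_norm; lra].
  have h2 := mono _ _ aS (ltW Sy) yb.
  have h3 : `|F y - F a| <= `|F y - F (sup S)| + `|F (sup S) - F a| by apply: ler_distD.
  case: SS => _ _ h4.
  rewrite [in X in _ <= X]ger0_norm in h1; lra.
move=> Sy'; have : y <= sup S by apply: ub_le_sup => //; case: Sub.
by rewrite leNgt Sy.
Qed.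

End real_integral.

Section primitive.
Context {R : realType}.
Local Notation mu := (@lebesgue_measure R).
Implicit Types (f g F G : R -> R) (l : R).

(** Local absolute continuity on (0, l) with density f, phrased through increments on compact
    subintervals: no pointwise derivative is involved and the endpoints stay out. *)
Definition primitive_on l F f := L1loc l f /\
  forall x y : R, 0 < x -> x <= y -> y < l -> F y - F x = \int[mu]_(t in `[x, y]) f t.

Lemma measurable_Iol l : measurable (Iol l).
Proof. exact: measurable_itv. Qed.

Lemma IolP l (x : R) : Iol l x <-> 0 < x /\ x < l.
Proof. by rewrite /Iol/= in_itv/=; split=> [/andP[]|[-> ->]]. Qed.

Lemma itv_sub_Iol l (x y : R) : 0 < x -> y < l -> `[x, y] `<=` Iol l.
Proof.
move=> x0 yl t /=; rewrite in_itv/= => /andP[xt ty]; apply/IolP.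
by split; [exact: lt_le_trans xt|exact: le_lt_trans yl].
Qed.

Lemma L1loc_integrable l f (x y : R) : L1loc l f -> 0 < x -> y < l ->
  mu.-integrable `[x, y] (EFin \o f).
Proof.
move=> [mf fi] x0 yl; have [xy|yx|xy] := ltgtP x y; first exact: fi.
- by rewrite set_itv_ge ?bnd_simp -?ltNge//; exact: integrable_set0.
(* [L1loc] speaks only of intervals with a < b, so the one-point interval is placed inside a longer
   one. *)
- apply: (@integrable_subitv _ (y / 2) y) => //; first by rewrite xy; lra.
  by apply: fi => //; lra.
Qed.

(** Near x, F is a constant plus the integral of f from x / 2, and such an integral is continuous in
    its upper bound. *)
Lemma primitive_continuous l F f : primitive_on l F f -> {in Iol l, continuous F}.
Proof.
move=> [fi Ff] x; rewrite inE => /IolP[x0 xl].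
have ab : x / 2 < (x + l) / 2 by lra.
have iab : mu.-integrable `[x / 2, (x + l) / 2] (EFin \o f).
  by apply: (L1loc_integrable fi); lra.
have := parameterized_integral_continuous (ltW ab) iab.
move/(continuous_within_itvP _ ab) => [+ _ _].
have xin : x \in `]x / 2, (x + l) / 2[ by rewrite in_itv/=; apply/andP; split; lra.
move=> /(_ x xin) h.
have {}h : F (x / 2) + \int[mu]_(t in `[x / 2, y]) f t @[y --> x] -->
    F (x / 2) + \int[mu]_(t in `[x / 2, x]) f t.
  by apply: cvgD => //; exact: cvg_cst.
rewrite /continuous_at; rewrite -(Ff (x / 2) x) in h; [|lra..].
rewrite addrC subrK in h; apply: cvg_trans h; apply: near_eq_cvg.
near=> y; have yl : y < l by near: y; exact: lt_nbhsl.
have xy : x / 2 <= y by apply/ltW; near: y; apply: lt_nbhsr; lra.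
by rewrite -(Ff (x / 2) y)//; [rewrite addrC subrK|lra].
Unshelve. all: by end_near. Qed.

Lemma primitive_measurable l F f : primitive_on l F f -> measurable_fun (Iol l) F.
Proof.
move=> /primitive_continuous cF; apply: subspace_continuous_measurable_fun.
  exact: measurable_Iol.
exact: continuous_in_subspaceT.
Qed.

Lemma primitive_bounded l F f (a b : R) : primitive_on l F f -> 0 < a -> b < l ->
  exists M : R, forall x : R, `[a, b]%classic x -> `|F x| <= M.
Proof.
move=> FF a0 bl; have [ab|ba] := leP a b; last first.
  by exists 0 => x /=; rewrite in_itv/= => /andP[h1 h2]; have := le_trans h1 h2; rewrite leNgt ba.
have c : {within `[a, b], continuous (fun x => `|F x|)}.
  apply: continuous_in_subspaceT => x; rewrite inE/= in_itv/= => /andP[xa xb].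
  apply: continuous_comp; last exact: norm_continuous.
  by apply: (primitive_continuous FF); rewrite inE; apply/IolP; split; lra.
by have [c0 _ Hc] := EVT_max ab c; exists `|F c0| => x xab; apply: Hc.
Qed.

Lemma primitive_measurable_itv l F f (a b : R) : primitive_on l F f -> 0 < a -> b < l ->
  measurable_fun `[a, b] F.
Proof.
move=> FF a0 bl; apply: measurable_funS (primitive_measurable FF).
  exact: measurable_Iol.
exact: itv_sub_Iol.
Qed.

Lemma primitive_mul_L1loc l F f g : primitive_on l F f -> L1loc l g ->
  L1loc l (fun x => F x * g x).
Proof.
move=> FF gi; split.
  by apply: measurable_funM; [exact: primitive_measurable FF|case: gi].
move=> a b a0 ab bl; have [M HM] := primitive_bounded FF a0 bl.
apply: (integrable_bounded_mul _ _ HM) => //; last exact: L1loc_integrable gi _ _.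
exact: primitive_measurable_itv FF _ _.
Qed.

Lemma L1locD l f g : L1loc l f -> L1loc l g -> L1loc l (fun x => f x + g x).
Proof.
move=> [mf fi] [mg gi]; split; first exact: measurable_funD.
by move=> a b a0 ab bl; apply: integrable_EFinD => //; [exact: fi|exact: gi].
Qed.

Lemma L1locB l f g : L1loc l f -> L1loc l g -> L1loc l (fun x => f x - g x).
Proof.
move=> [mf fi] [mg gi]; split; first exact: measurable_funB.
by move=> a b a0 ab bl; apply: integrable_EFinB => //; [exact: fi|exact: gi].
Qed.

Lemma primitiveB l F G f g : primitive_on l F f -> primitive_on l G g ->
  primitive_on l (fun x => F x - G x) (fun x => f x - g x).
Proof.
move=> [fi Ff] [gi Gg]; split; first exact: L1locB.
move=> x y x0 xy yl; rewrite RintegralB//; [|exact: (L1loc_integrable fi)|exact: (L1loc_integrable gi)].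
by rewrite -Ff// -Gg//; ring.
Qed.

Lemma primitive_ae l F f g : primitive_on l F f -> L1loc l g -> ae_eq_on l f g ->
  primitive_on l F g.
Proof.
move=> [fi Ff] gi fg; split => // x y x0 xy yl; rewrite Ff//.
have sub : `[x, y] `<=` Iol l by exact: itv_sub_Iol.
apply: Rintegral_ae_eq => //.
- by apply: measurable_funS sub _; [exact: measurable_Iol|case: fi].
- by apply: measurable_funS sub _; [exact: measurable_Iol|case: gi].
- by apply: (ae_imply fg) => t h /sub; exact: h.
Qed.

(** The defect [Phi] of the product rule changes over [x, y] by at most e times the integral of |f|
    + |g| whenever F and G oscillate by at most e there. Continuity provides this locally,
    [increment_le_of_local] makes it global, and e is arbitrary. *)
Lemma primitiveM l F G f g : primitive_on l F f -> primitive_on l G g ->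
  primitive_on l (fun x => F x * G x) (fun x => F x * g x + G x * f x).
Proof.
move=> FF GG; have [fi Ff] := FF; have [gi Gg] := GG.
have Fgi := primitive_mul_L1loc FF gi; have Gfi := primitive_mul_L1loc GG fi.
split; first exact: L1locD.
move=> a b a0 ab bl.
have ifI (x y : R) : 0 < x -> y < l -> mu.-integrable `[x, y] (EFin \o f).
  exact: L1loc_integrable.
have igI (x y : R) : 0 < x -> y < l -> mu.-integrable `[x, y] (EFin \o g).
  exact: L1loc_integrable.
pose N t := `|f t| + `|g t|.
have Ni : mu.-integrable `[a, b] (EFin \o N).
  by apply: integrable_EFinD => //; apply: integrable_norm; [exact: ifI|exact: igI].
have Hi : mu.-integrable `[a, b] (EFin \o (fun x => F x * g x + G x * f x)).
  by apply: integrable_EFinD => //; [exact: (L1loc_integrable Fgi)|exact: (L1loc_integrable Gfi)].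
pose Phi y := F y * G y - \int[mu]_(t in `[a, y]) (F t * g t + G t * f t).
have key (x y e : R) : a <= x -> x <= y -> y <= b ->
    (forall t : R, x <= t -> t <= y -> `|F x - F t| <= e /\ `|G y - G t| <= e) ->
    `|Phi y - Phi x| <= e * \int[mu]_(t in `[x, y]) N t.
  move=> ax xy yb osc.
  have x0 : 0 < x by lra.
  have yl : y < l by lra.
  have ixy h : mu.-integrable `[a, b] (EFin \o h) -> mu.-integrable `[x, y] (EFin \o h).
    exact: integrable_subitv.
  (* From F(y)G(y) - F(x)G(x) = F(x)(G(y) - G(x)) + G(y)(F(y) - F(x)), with both increments written
     as integrals. *)
  have -> : Phi y - Phi x =
      \int[mu]_(t in `[x, y]) ((F x - F t) * g t + (G y - G t) * f t).
    rewrite /Phi (@Rintegral_split _ a y x)//; last exact: integrable_subitv Hi.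
    transitivity (\int[mu]_(t in `[x, y]) ((F x * g t + G y * f t) -
                    (F t * g t + G t * f t))); last first.
      by apply: eq_Rintegral => t _; ring.
    have E1 : \int[mu]_(t in `[x, y]) (F x * g t + G y * f t) =
        F x * (G y - G x) + G y * (F y - F x).
      rewrite RintegralD//; [|by apply: integrable_EFinZ => //; exact: igI
                             |by apply: integrable_EFinZ => //; exact: ifI].
      by rewrite !RintegralZl// -?Ff// -?Gg//; [exact: ifI|exact: igI].
    rewrite RintegralB//; last 2 first.
    - by apply: integrable_EFinD => //; apply: integrable_EFinZ => //; [exact: igI|exact: ifI].
    - exact: ixy.
    by rewrite E1; ring.
  have Ki : mu.-integrable `[x, y]
      (EFin \o (fun t => (F x - F t) * g t + (G y - G t) * f t)).
    apply: integrable_EFinD => //.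
    + apply: (@integrable_bounded_mul _ _ _ (fun t => F x - F t) e) => //; last exact: igI.
        by apply: measurable_funB => //; exact: primitive_measurable_itv FF _ _.
      by move=> t /=; rewrite in_itv/= => /andP[? ?]; apply osc.
    + apply: (@integrable_bounded_mul _ _ _ (fun t => G y - G t) e) => //; last exact: ifI.
        by apply: measurable_funB => //; exact: primitive_measurable_itv GG _ _.
      by move=> t /=; rewrite in_itv/= => /andP[? ?]; apply osc.
  apply: le_trans (le_normr_Rintegral _ Ki) _ => //.
  rewrite -RintegralZl//; last exact: ixy.
  apply: le_Rintegral => //; [exact: integrable_norm|by apply: integrable_EFinZ => //; exact: ixy|].
  move=> t /=; rewrite in_itv/= => /andP[xt ty]; have [h1 h2] := osc t xt ty.
  rewrite (le_trans (ler_normD _ _))// !normrM /N mulrDr addrC.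
  by apply: lerD; rewrite ler_wpM2r.
have bound (e : R) : 0 < e -> `|Phi b - Phi a| <= e * \int[mu]_(t in `[a, b]) N t.
  move=> e0.
  pose m y := e * \int[mu]_(t in `[a, y]) N t.
  have mE (x y : R) : a <= x -> x <= y -> y <= b -> m y - m x = e * \int[mu]_(t in `[x, y]) N t.
    move=> ax xy yb; rewrite /m (@Rintegral_split _ a y x)//; first by ring.
    exact: integrable_subitv Ni.
  have N0 (x y : R) : 0 <= \int[mu]_(t in `[x, y]) N t.
    by apply: Rintegral_ge0 => t _; rewrite /N addr_ge0.
  have -> : e * \int[mu]_(t in `[a, b]) N t = m b - m a by rewrite mE.
  apply: increment_le_of_local => //.
    by move=> x y ax xy yb; rewrite -subr_ge0 mE// mulr_ge0// ltW.
  move=> x ax xb.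
  have xin : x \in Iol l by rewrite inE; apply/IolP; split; lra.
  (* Two points near x are compared through x, hence half of e for each. *)
  have e20 : 0 < e / 2 by lra.
  have := primitive_continuous FF xin => /cvgrPdist_le /(_ _ e20) hF.
  have := primitive_continuous GG xin => /cvgrPdist_le /(_ _ e20) hG.
  have [d d0 Hd] : \forall t \near x, `|F x - F t| <= e / 2 /\ `|G x - G t| <= e / 2.
    by near=> t; split; near: t.
  have osc (s t : R) : `|x - s| < d -> `|x - t| < d -> `|F s - F t| <= e /\ `|G s - G t| <= e.
    move=> /Hd[sF sG] /Hd[tF tG]; split.
      by rewrite (le_trans (ler_distD (F x) _ _))// [X in X + _]distrC; lra.
    by rewrite (le_trans (ler_distD (G x) _ _))// [X in X + _]distrC; lra.
  exists d => // y ay yb; rewrite distrC => xyd.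
  have [xy|/ltW yx] := leP x y.
    rewrite [X in _ <= X]ger0_norm; last by rewrite mE// mulr_ge0// ltW.
    rewrite mE//; apply: key => // t xt ty; split.
      by have [] := osc x t; rewrite ?subrr ?normr0//; rewrite ler0_norm; [rewrite ler0_norm in xyd|]; lra.
    by have [] := osc y t xyd => //; rewrite ler0_norm; [rewrite ler0_norm in xyd|]; lra.
  rewrite distrC [X in _ <= X]distrC.
  rewrite [X in _ <= X]ger0_norm; last by rewrite mE// mulr_ge0// ltW.
  rewrite mE//; apply: key => // t xt ty; split.
    by have [] := osc y t xyd => //; rewrite ger0_norm; [rewrite ger0_norm in xyd|]; lra.
  by have [] := osc x t; rewrite ?subrr ?normr0//; rewrite ger0_norm; [rewrite ger0_norm in xyd|]; lra.
have Phi0 : `|Phi b - Phi a| <= 0.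
  have I0 : 0 <= \int[mu]_(t in `[a, b]) N t.
    by apply: Rintegral_ge0 => t _; rewrite /N addr_ge0.
  exact: (le0_of_le_eps I0 bound).
move: Phi0; rewrite normr_le0 subr_eq0 => /eqP.
by rewrite /Phi set_itv1 Rintegral_set1 => h; lra.
Unshelve. all: by end_near. Qed.

End primitive.

(** * Weak derivatives *)

Section weak_derivative.
Context {R : realType}.
Local Notation mu := (@lebesgue_measure R).
Implicit Types (f g F G : R -> R) (l : R).

Lemma ae_Iol_exhaust l (P : R -> Prop) :
  (forall a b : R, 0 < a -> a < b -> b < l -> {ae mu, forall x, a < x -> x < b -> P x}) ->
  {ae mu, forall x, Iol l x -> P x}.
Proof.
move=> H; have [l0|l0] := leP l 0.
  by apply: aeW => x /IolP[x0 xl]; have := lt_trans x0 xl; rewrite ltNge l0.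
(* Starting the denominators at 3 gives a n <= l / 3, so a n < l - a n for every n. *)
pose a (n : nat) : R := l / n.+3%:R.
have n3 n : (3 : R) <= n.+3%:R by rewrite ler_nat.
have a0 n : 0 < a n by rewrite divr_gt0.
have a3 n : a n <= l / 3 by rewrite ler_pM2l// lef_pV2// ?posrE//; have := n3 n; lra.
have Hn n : {ae mu, forall x, a n < x -> x < l - a n -> P x}.
  by apply: H => //; have := a0 n; have := a3 n; lra.
apply: (ae_imply (ae_foralln Hn)) => x Hx /IolP[x0 xl].
pose m := Order.min x (l - x).
have m0 : 0 < m by rewrite lt_min x0/= subr_gt0.
have := truncnS_gt (l / m); set n := Num.trunc _ => hn.
have am : a n < m.
  rewrite /a ltr_pdivrMr ?ltr0n// mulrC -ltr_pdivrMr//.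
  by apply: lt_le_trans hn _; rewrite ler_nat ltnS; exact: leqW.
have mx : m <= x by rewrite ge_min lexx.
have mlx : m <= l - x by rewrite ge_min lexx orbT.
by apply: (Hx n); lra.
Qed.

Lemma ae_itv_exists (a b : R) (P : R -> Prop) : a < b ->
  {ae mu, forall x, a < x -> x < b -> P x} -> exists x, [/\ a < x, x < b & P x].
Proof.
move=> ab [N [mN N0 sub]]; apply: contrapT => nex.
have sN : `]a, b[ `<=` N.
  move=> x /=; rewrite in_itv/= => /andP[ax xb].
  by apply: sub => /= /(_ ax xb) Px; apply: nex; exists x.
have : mu `]a, b[ = 0%E.
  by apply/eqP; rewrite -measure_le0 -N0; apply: le_measure; rewrite ?inE//.
rewrite lebesgue_measure_itv/= lte_fin ab => /eqP; rewrite -EFinD eqe subr_eq0 => /eqP h.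
by rewrite h ltxx in ab.
Qed.

(** At a Lebesgue point x the integral of f from a to y has derivative f(x) in y, yet it is
    identically 0. The truncation [k] supplies a function that is integrable on the whole line. *)
Lemma integral_eq0_ae_eq0 l f : L1loc l f ->
  (forall x y : R, 0 < x -> x <= y -> y < l -> \int[mu]_(t in `[x, y]) f t = 0) ->
  ae_eq_on l f (fun=> 0).
Proof.
move=> fi f0; apply: ae_Iol_exhaust => a b a0 ab bl.
have iab : mu.-integrable `[a, b] (EFin \o f) by exact: (L1loc_integrable fi).
pose k := f \_ `[a, b].
have kE : {in `[a, b], k =1 f}.
  by move=> x xab; rewrite /k patchE mem_set.
have ki : mu.-integrable `[a, b] (EFin \o k).
  by apply: eq_integrable iab => //= x /set_mem xab; rewrite kE.
have lk := lebesgue_differentiation (integrable_locally (measurable_itv _) iab).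
apply: (ae_imply lk) => x lx ax xb.
have [_ ] := @FTC1_lebesgue_pt _ k (BLeft a) x b xb ki ax lx.
rewrite derive1E (@near_eq_derive _ _ _ _ (cst 0)).
  by rewrite derive_cst kE// in_itv/= !ltW.
near=> y.
have yb : y < b by near: y; exact: lt_nbhsl.
have ay : a < y by near: y; exact: lt_nbhsr.
rewrite -[RHS](f0 a y) ?(ltW ay)//; last exact: lt_trans bl.
apply: eq_Rintegral => t /set_mem /=; rewrite in_itv/= => /andP[at1 ty].
by rewrite kE// in_itv/= at1 (le_trans ty)// ltW.
Unshelve. all: by end_near. Qed.

Lemma primitive_uniq l F f g : primitive_on l F f -> primitive_on l F g -> ae_eq_on l f g.
Proof.
move=> [fi Ff] [gi Fg].
have : ae_eq_on l (fun x => f x - g x) (fun=> 0).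
  apply: integral_eq0_ae_eq0; first exact: L1locB.
  move=> x y x0 xy yl; rewrite RintegralB//.
  - by rewrite -Ff// -Fg// subrr.
  - exact: (L1loc_integrable fi).
  - exact: (L1loc_integrable gi).
by move=> h; apply: (ae_imply h) => x /[apply] /eqP; rewrite subr_eq0 => /eqP.
Qed.

Lemma Rintegral_support (A B : set R) f : A `<=` B ->
  (forall x, B x -> ~ A x -> f x = 0) ->
  \int[mu]_(x in B) f x = \int[mu]_(x in A) f x.
Proof.
move=> AB f0; rewrite Rintegral_mkcond [RHS]Rintegral_mkcond.
apply: eq_Rintegral => x _; rewrite !patchE.
case: ifPn => [/set_mem Bx|/negP nB]; case: ifPn => [/set_mem Ax|/negP nA] //.
- by apply: f0 => // Ax; apply: nA; exact: mem_set.
- by exfalso; apply: nB; apply/mem_set/AB.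
Qed.

(** Climbs from 0 to 1 across [c, c + d], so its derivative is an approximate identity of mass one
    lying to the right of c. *)
Definition step_at (c d x : R) : R := smooth_step (d^-1 * x + (- (c / d))).

Lemma is_derive_step_at (c d x : R) : is_derive x 1 (step_at c d)
  (d^-1 * derive1 smooth_step (d^-1 * x + (- (c / d)))).
Proof. by apply: is_derive_affine; exact: derivable_smooth_step. Qed.

Lemma step_atE (c d x : R) : 0 < d -> d^-1 * x + (- (c / d)) = (x - c) / d.
Proof. by move=> d0; rewrite mulrBl mulrC. Qed.

Lemma step_at0 (c d x : R) : 0 < d -> x <= c -> step_at c d x = 0.
Proof.
move=> d0 xc; rewrite /step_at step_atE// smooth_step0//.
by rewrite pmulr_lle0 ?invr_gt0// subr_le0.
Qed.

Lemma step_at1 (c d x : R) : 0 < d -> c + d <= x -> step_at c d x = 1.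
Proof.
move=> d0 xc; rewrite /step_at step_atE// smooth_step1//.
by rewrite ler_pdivlMr// mul1r; lra.
Qed.

Lemma derive1_step_at_out (c d x : R) : 0 < d -> ~ `[c, c + d]%classic x ->
  derive1 (step_at c d) x = 0.
Proof.
move=> d0 xn; have [_ /[!derive1E] ->] := is_derive_step_at c d x.
rewrite -derive1E derive1_smooth_step_out ?mulr0// step_atE//= in_itv/= => /andP[h1 h2].
apply: xn => /=; rewrite in_itv/=; apply/andP; split.
  by move: h1; rewrite pmulr_lge0 ?invr_gt0// subr_ge0.
by move: h2; rewrite ler_pdivrMr// mul1r; lra.
Qed.

Lemma continuous_derive1_step_at (c d : R) : continuous (derive1 (step_at c d)).
Proof.
have [_] := @smoothn_affine R 2 _ d^-1 (- (c / d)) (smoothn_smooth_step 2).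
move=> [dd _] x; apply: differentiable_continuous; apply/derivable1_diffP; exact: dd.
Qed.

Lemma Rintegral_derive1_step_at (c d : R) : 0 < d ->
  \int[mu]_(x in `[c, c + d]) derive1 (step_at c d) x = 1.
Proof.
move=> d0; have cd : c < c + d by lra.
rewrite /Rintegral (@continuous_FTC2 _ _ (step_at c d))//.
- by rewrite step_at1// step_at0//= subr0.
- by apply: continuous_subspaceT; exact: continuous_derive1_step_at.
- have ct x : {for x, continuous (step_at c d)}.
    apply: differentiable_continuous; apply/derivable1_diffP.
    by have [] := is_derive_step_at c d x.
  split; first by move=> x _; have [] := is_derive_step_at c d x.
    by apply: cvg_at_right_filter; exact: ct.
  by apply: cvg_at_left_filter; exact: ct.
Qed.

Lemma derive1_step_at_bounded : exists2 M : R, 0 < M &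
  forall c d x : R, 0 < d -> `|derive1 (step_at c d) x| <= M / d.
Proof.
have [M M0 HM] := @derive1_smooth_step_bounded R.
exists M => // c d x d0; have [_ /[!derive1E] ->] := is_derive_step_at c d x.
rewrite normrM mulrC -derive1E normfV (gtr0_norm d0).
by rewrite ler_wpM2r// invr_ge0 ltW.
Qed.

(** Since the kernel has mass one, f(c) can be moved under the integral; the kernel is at most M / d
    and the deviation of f has integral at most d e. *)
Lemma step_average f (c d e M : R) : 0 < d -> 0 <= M ->
  (forall x, `|derive1 (step_at c d) x| <= M / d) ->
  mu.-integrable `[c, c + d] (EFin \o f) ->
  \int[mu]_(x in `[c, c + d]) `|f x - f c| <= d * e ->
  `|\int[mu]_(x in `[c, c + d]) (f x * derive1 (step_at c d) x) - f c| <= M * e.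
Proof.
move=> d0 M0 HM fi fe; have cd : c <= c + d by lra.
have ms : measurable_fun `[c, c + d] (derive1 (step_at c d)).
  apply: measurable_funTS; apply: continuous_measurable_fun.
  exact: continuous_derive1_step_at.
have fci : mu.-integrable `[c, c + d] (EFin \o (fun x => f x - f c)).
  by apply: integrable_EFinB => //; exact: integrable_itv_cst.
have si h : mu.-integrable `[c, c + d] (EFin \o h) ->
    mu.-integrable `[c, c + d] (EFin \o (fun x => h x * derive1 (step_at c d) x)).
  by move=> hi; apply: (@integrable_mul_bounded _ _ _ _ (M / d)).
have -> : \int[mu]_(x in `[c, c + d]) (f x * derive1 (step_at c d) x) - f c =
    \int[mu]_(x in `[c, c + d]) ((f x - f c) * derive1 (step_at c d) x).
  transitivity (\int[mu]_(x in `[c, c + d]) (f x * derive1 (step_at c d) x -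
      f c * derive1 (step_at c d) x)); last by apply: eq_Rintegral => x _; ring.
  rewrite RintegralB//; [|exact: si|].
    rewrite RintegralZl// ?Rintegral_derive1_step_at ?mulr1//.
    have := si _ (integrable_itv_cst c (c + d) 1); apply: eq_integrable => // x _ /=.
    by rewrite mul1r.
  by apply: si; exact: integrable_itv_cst.
apply: le_trans (le_normr_Rintegral _ (si _ fci)) _ => //.
apply: (@le_trans _ _ (M / d * \int[mu]_(x in `[c, c + d]) `|f x - f c|)).
  rewrite -RintegralZl//; last exact: integrable_norm.
  apply: le_Rintegral => //.
  - by apply: integrable_norm; exact: si.
  - by apply: integrable_EFinZ => //; exact: integrable_norm.
  - by move=> x _; rewrite normrM mulrC ler_wpM2r.
have Md : 0 <= M / d by rewrite divr_ge0// ltW.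
apply: le_trans (ler_wpM2l Md fe) _.
by rewrite mulrA divfK// gt_eqF.
Qed.

Lemma lebesgue_pt_average f (a b c e : R) : a < c -> c < b ->
  mu.-integrable `[a, b] (EFin \o f) -> lebesgue_pt (f \_ `[a, b]) c -> 0 < e ->
  exists2 d0, 0 < d0 & forall d, 0 < d -> d < d0 ->
    \int[mu]_(x in `[c, c + d]) `|f x - f c| <= d * e.
Proof.
move=> ac cb fi lp e0; pose k := f \_ `[a, b].
have kE : {in `[a, b], k =1 f} by move=> x xab; rewrite /k patchE mem_set.
have kc : k c = f c by rewrite kE// in_itv/= !ltW.
(* The one-sided interval [c, c + d] sits in the open ball of radius 2d, whose measure is 4d. *)
have e40 : 0 < e / 4 by lra.
have : \forall r \near (0:R)^'+, (davg k c r < (e / 4)%:E)%E.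
  have := lp [set y | (y < (e / 4)%:E)%E]; apply.
  by apply: open_ereal_lt'; rewrite lte_fin.
move=> [r0 /= r00 Hr].
(* The first bound puts the radius 2d below r0; the second keeps [c, c + d] in [a, b], where the
   truncation agrees with f. *)
exists (Order.min (r0 / 2) (b - c)); first by rewrite lt_min; apply/andP; split; lra.
move=> d d0; rewrite lt_min => /andP[dr db].
have d20 : 0 < 2 * d by lra.
have := Hr (2 * d); rewrite /= sub0r normrN gtr0_norm// => /(_ _ d20) => h.
have {}h : (davg k c (2 * d) < (e / 4)%:E)%E by apply: h; lra.
move: h; rewrite /davg /iavg lebesgue_measure_ball ?(ltW d20)//.
rewrite inver mulrn_eq0/= gt_eqF// => /ltW; rewrite lee_pdivrMl; last by rewrite pmulrn_lgt0.
rewrite -EFinM => h.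
have sub : `[c, c + d] `<=` ball c (2 * d).
  move=> x /=; rewrite in_itv/= /ball/= => /andP[cx xcd].
  by rewrite ler0_norm; lra.
have subab x : `[c, c + d]%classic x -> x \in `[a, b].
  by rewrite /= !in_itv/= => /andP[cx xcd]; apply/andP; split; lra.
have mk : measurable_fun setT k.
  by apply/(measurable_restrictT _ _).1 => //; exact: integrable_measurable.
set A := `[c, c + d]%classic in sub subab *.
have hle : (\int[mu]_(x in A) (`|f x - f c|)%:E <= (d * e)%:E)%E.
  have -> : (d * e)%:E = ((2 * d) *+ 2 * (e / 4))%:E by congr EFin; field.
  apply: le_trans h.
  have -> : (\int[mu]_(x in A) (`|f x - f c|)%:E =
     \int[mu]_(x in A) `| ((center (k c) \o k) x)%:E |)%E.
    by apply: eq_integral => x /set_mem /subab xab /=; rewrite kE// kc.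
  apply: ge0_subset_integral => //; [exact: measurable_itv|exact: measurable_ball|].
  apply: measurable_funTS; apply: measurableT_comp => //; apply/measurable_EFinP.
  exact: measurable_funD.
rewrite /Rintegral -lee_fin fineK// ge0_fin_numE; last exact: integral_ge0.
by apply: le_lt_trans hle _; rewrite ltry.
Qed.

Lemma small_integral_right g (a b e : R) : a < b -> 0 < e ->
  mu.-integrable `[a, b] (EFin \o g) ->
  exists2 d0 : R, 0 < d0 & forall d : R, 0 < d -> d < d0 ->
    \int[mu]_(x in `[a, a + d]) `|g x| <= e.
Proof.
move=> ab e0 gi.
have [d0 /= d00 H] := parameterized_integral_near_left ab e0 (integrable_norm gi).
exists d0 => // d dp dd; have := H (a + d).
rewrite /= opprD addNKr normrN gtr0_norm// => /(_ dd).
have ad : a <= a + d by lra.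
by move=> /(_ ad)/ltW; apply: le_trans; exact: ler_norm.
Qed.

(** The smooth approximation of the indicator of [a, b]. Both ramps lie to the right of their base
    point, so its derivative averages f to the right of a and, with opposite sign, to the right of
    b. *)
Definition plateau (a b d x : R) : R := step_at a d x + (-1) * step_at b d x.

Lemma smoothn_step_at n (c d : R) : smoothn n (step_at c d).
Proof. by apply: smoothn_affine; exact: smoothn_smooth_step. Qed.

Lemma plateau_out (a b d x : R) : 0 < d -> a < b -> ~ `[a, b + d]%classic x ->
  plateau a b d x = 0.
Proof.
move=> d0 ab /=; rewrite in_itv/= => /negP; rewrite negb_and -!ltNge /plateau => /orP[xa|bx].
  by rewrite !step_at0; [ring|lra..].
by rewrite !step_at1; [ring|lra..].
Qed.

Lemma test_fun_plateau l (a b d : R) : 0 < a -> a < b -> 0 < d -> b + d < l ->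
  test_fun l (plateau a b d).
Proof.
move=> a0 ab d0 bl; split.
  move=> n; apply: smoothn_derive1n; apply: smoothnD; first exact: smoothn_step_at.
  by apply: smoothnM; [exact: smoothn_cst|exact: smoothn_step_at].
exists a, (b + d); split => //; first lra.
by move=> x; exact: plateau_out.
Qed.

Lemma derive1_plateau (a b d x : R) : derive1 (plateau a b d) x =
  derive1 (step_at a d) x - derive1 (step_at b d) x.
Proof.
have da c : derivable (step_at c d) x 1 by have [] := is_derive_step_at c d x.
rewrite !derive1E (_ : plateau a b d = step_at a d - step_at b d) ?deriveB//.
by apply/funext => y; rewrite /plateau mulN1r.
Qed.

Lemma step_at_bounds (c d x : R) : 0 <= step_at c d x <= 1.
Proof. by rewrite smooth_step_ge0 smooth_step_le1. Qed.

Lemma continuous_step_at (c d : R) : continuous (step_at c d).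
Proof.
move=> x; apply: differentiable_continuous; apply/derivable1_diffP.
by have [] := is_derive_step_at c d x.
Qed.

(** Testing with [plateau a b d], the left side of the weak formula tends to f(a) - f(b) by the
    Lebesgue point property and the right side to minus the integral of g over [a, b]. The margin
    between b and q leaves room for the second ramp. *)
Lemma weak_deriv_increment l f g (p q a b : R) : weak_deriv l f g ->
  0 < p -> p < a -> a < b -> b < q -> q < l ->
  lebesgue_pt (f \_ `[p, q]) a -> lebesgue_pt (f \_ `[p, q]) b ->
  f b - f a = \int[mu]_(x in `[a, b]) g x.
Proof.
move=> [fl [gl fg]] p0 pa ab bq ql la lb.
have fi : mu.-integrable `[p, q] (EFin \o f) by apply: (L1loc_integrable fl).
have gi : mu.-integrable `[p, q] (EFin \o g) by apply: (L1loc_integrable gl).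
have [M M0 HM] := derive1_step_at_bounded.
apply/eqP; rewrite -subr_eq0 -normr_le0.
(* Four errors: M e from each of the two ramp averages of f, and e from g on each ramp. *)
have K0 : 0 <= 2 * M + 2 by lra.
apply: (le0_of_le_eps K0) => e e0.
have aq : a < q by lra.
have pb : p < b by lra.
have [d1 d10 H1] := lebesgue_pt_average pa aq fi la e0.
have [d2 d20 H2] := lebesgue_pt_average pb bq fi lb e0.
have gia : mu.-integrable `[a, q] (EFin \o g) by apply: integrable_subitv gi => //; lra.
have gib : mu.-integrable `[b, q] (EFin \o g) by apply: integrable_subitv gi => //; lra.
have [d3 d30 H3] := small_integral_right aq e0 gia.
have [d4 d40 H4] := small_integral_right bq e0 gib.
(* Besides the four smallness conditions, d < b - a separates the two ramps and d < q - b keeps the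
   support inside [p, q]. *)
have [d [d0 dd1 dd2 dd3 [dd4 dab dq]]] : exists d : R,
    [/\ 0 < d, d < d1, d < d2, d < d3 & [/\ d < d4, d < b - a & d < q - b]].
  near (0:R)^'+ => d; exists d; split; [ | | | |split].
  - by near: d; exact: nbhs_right_gt.
  - by near: d; exact: nbhs_right_lt.
  - by near: d; exact: nbhs_right_lt.
  - by near: d; exact: nbhs_right_lt.
  - by near: d; exact: nbhs_right_lt.
  - by near: d; apply: nbhs_right_lt; rewrite subr_gt0.
  - by near: d; apply: nbhs_right_lt; rewrite subr_gt0.
have bdl : b + d < l by lra.
have a0 : 0 < a by lra.
pose phi := plateau a b d; pose K := `[p, q]%classic.
have KI : K `<=` Iol l by exact: itv_sub_Iol.
have outc (c x : R) : p <= c -> c <= b -> ~ K x -> ~ `[c, c + d]%classic x.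
  move=> pc cb nK /=; rewrite in_itv/= => /andP[h1 h2]; apply: nK.
  by rewrite /K/= in_itv/=; lra.
have subc (c : R) : p <= c -> c <= b -> `[c, c + d] `<=` K.
  by move=> pc cb x; rewrite /K/= !in_itv/= => /andP[h1 h2]; lra.
have pla : p <= a by lra.
have alb : a <= b by lra.
have plb : p <= b by lra.
have blq : b <= q by lra.
have adq : a + d <= q by lra.
have bdq : b + d <= q by lra.
have adb : a + d <= b by lra.
have bbd : b <= b + d by lra.
have abd : a <= b + d by lra.
have sab : `[a, b + d] `<=` Iol l by exact: itv_sub_Iol.
have sub : `[a, a + d] `<=` `[a, b] by apply: subset_itv; rewrite bnd_simp.
have step1 (c x : R) : `|step_at c d x - 1| <= 1.
  by have /andP[? ?] := step_at_bounds c d x; rewrite ler_norml; lra.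
have phi1 x : `|phi x| <= 1.
  rewrite /phi /plateau; have /andP[? ?] := step_at_bounds a d x.
  by have /andP[? ?] := step_at_bounds b d x; rewrite ler_norml; lra.
have {}H1 := H1 _ d0 dd1; have {}H2 := H2 _ d0 dd2.
have {}H3 := H3 _ d0 dd3; have {}H4 := H4 _ d0 dd4.
have mcont (h : R -> R) (A : set R) : continuous h -> measurable_fun A h.
  by move=> ch; apply: measurable_funTS; exact: continuous_measurable_fun.
have si c : mu.-integrable K (EFin \o (fun x => f x * derive1 (step_at c d) x)).
  have ms := mcont _ K (@continuous_derive1_step_at c d).
  apply: (@integrable_mul_bounded _ K f _ (M / d)) => //; first exact: measurable_itv.
  by move=> x _; exact: HM.
have E1 : \int[mu]_(x in Iol l) (f x * derive1 phi x) =
    \int[mu]_(x in `[a, a + d]) (f x * derive1 (step_at a d) x) -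
    \int[mu]_(x in `[b, b + d]) (f x * derive1 (step_at b d) x).
  rewrite (Rintegral_support KI); last first.
    move=> x _ nK; rewrite derive1_plateau !derive1_step_at_out ?subrr ?mulr0//.
    - exact: outc nK.
    - exact: outc nK.
  rewrite -(Rintegral_support (subc _ pla alb)); last first.
    by move=> x _ nx; rewrite derive1_step_at_out ?mulr0.
  rewrite -(Rintegral_support (subc _ plb (lexx b))); last first.
    by move=> x _ nx; rewrite derive1_step_at_out ?mulr0.
  rewrite -RintegralB//; last exact: measurable_itv.
  by apply: eq_Rintegral => x _; rewrite derive1_plateau mulrBr.
have fia : mu.-integrable `[a, a + d] (EFin \o f) by exact: integrable_subitv fi.
have fib : mu.-integrable `[b, b + d] (EFin \o f) by exact: integrable_subitv fi.
have {}H1 := step_average d0 (ltW M0) (fun x => HM a d x d0) fia H1.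
have {}H2 := step_average d0 (ltW M0) (fun x => HM b d x d0) fib H2.
have mphi (A : set R) : measurable_fun A phi.
  apply: mcont => x; apply: cvgD; first exact: continuous_step_at.
  by apply: cvgM; [exact: cvg_cst|exact: continuous_step_at].
have gphii (x y : R) : p <= x -> y <= q -> mu.-integrable `[x, y] (EFin \o (fun x => g x * phi x)).
  move=> px yq; have gxy : mu.-integrable `[x, y] (EFin \o g) by apply: integrable_subitv gi.
  exact: (@integrable_mul_bounded _ _ _ _ 1).
have gii (x y : R) : p <= x -> y <= q -> mu.-integrable `[x, y] (EFin \o g).
  by move=> px yq; apply: integrable_subitv gi.
have E2 : \int[mu]_(x in Iol l) (g x * phi x) =
    \int[mu]_(x in `[a, b]) (g x * phi x) + \int[mu]_(x in `[b, b + d]) (g x * phi x).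
  rewrite (Rintegral_support sab); last first.
    by move=> x _ nx; rewrite /phi plateau_out ?mulr0.
  by apply: Rintegral_split => //; exact: gphii.
have B4 : `|\int[mu]_(x in `[b, b + d]) (g x * phi x)| <= e.
  have gp : mu.-integrable `[b, b + d] (EFin \o (fun x => g x * phi x)) by exact: gphii.
  apply: le_trans (le_normr_Rintegral _ gp) _ => //; apply: le_trans H4.
  apply: le_Rintegral => //; [exact: integrable_norm|by apply: integrable_norm; exact: gii|].
  by move=> x _; rewrite normrM ler_piMr.
have B3 : `|\int[mu]_(x in `[a, b]) (g x * phi x) - \int[mu]_(x in `[a, b]) g x| <= e.
  have gab : mu.-integrable `[a, b] (EFin \o g) by exact: gii.
  have gp : mu.-integrable `[a, b] (EFin \o (fun x => g x * phi x)) by exact: gphii.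
  rewrite -RintegralB//.
  have gpi : mu.-integrable `[a, b] (EFin \o (fun x => g x * phi x - g x)).
    exact: integrable_EFinB.
  apply: le_trans (le_normr_Rintegral _ gpi) _ => //; apply: le_trans H3.
  (* The plateau equals 1 on (a + d, b], so the difference lives on the first ramp. *)
  rewrite (Rintegral_support sub); last first.
    move=> x /=; rewrite in_itv/= => /andP[ax xb] /negP; rewrite in_itv/= ax/= -ltNge => adx.
    rewrite /phi /plateau step_at1 ?(ltW adx)// step_at0//.
    by rewrite mulr0 addr0 mulr1 subrr normr0.
  apply: le_Rintegral => //.
  - by apply: integrable_norm; apply: integrableS gpi.
  - by apply: integrable_norm; exact: gii.
  - move=> x /sub /=; rewrite in_itv/= => /andP[ax xb].
    have -> : g x * phi x - g x = g x * (phi x - 1) by ring.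
    rewrite normrM ler_piMr//; rewrite /phi /plateau [step_at b d x]step_at0//.
    by rewrite mulr0 addr0; exact: step1.
have E0 := fg _ (test_fun_plateau a0 ab d0 bdl); rewrite E1 E2 in E0.
move: E0 H1 H2 B3 B4.
set J1 := \int[mu]_(x in _) _; set J2 := \int[mu]_(x in _) _.
set J3 := \int[mu]_(x in _) _; set J4 := \int[mu]_(x in _) _.
set J5 := \int[mu]_(x in _) _.
rewrite !ler_norml.
move: (f a) (f b) J1 J2 J3 J4 J5 K0 => fa fb J1 J2 J3 J4 J5 K0.
clear -K0 => E0 /andP[? ?] /andP[? ?] /andP[? ?] /andP[? ?].
by apply/andP; split; lra.
Unshelve. all: by end_near. Qed.

(** Between any two common Lebesgue points f already has the increments of a primitive of g;
    integrating g from one such point extends this to all of (0, l) and changes f only on a null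
    set. *)
Lemma weak_deriv_primitive l f g : 0 < l -> weak_deriv l f g ->
  exists2 F, primitive_on l F g & ae_eq_on l f F.
Proof.
move=> l0 fg; have [fl [gl _]] := fg.
pose a (n : nat) : R := l / n.+3%:R.
have n3 n : (3 : R) <= n.+3%:R by rewrite ler_nat.
have a0 n : 0 < a n by rewrite divr_gt0.
have a3 n : a n <= l / 3 by rewrite ler_pM2l// lef_pV2// ?posrE//; have := n3 n; lra.
(* f is integrable only away from the endpoints, so Lebesgue points are taken for countably many
   truncations at once. *)
pose good (x : R) := forall n, lebesgue_pt (f \_ `[a n, l - a n]) x.
have aegood : {ae mu, forall x, good x}.
  apply: ae_foralln => n; apply: lebesgue_differentiation; apply: integrable_locally => //.
  by apply: (L1loc_integrable fl) => //; have := a0 n; lra.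
have incr (x y : R) : 0 < x -> x < y -> y < l -> good x -> good y ->
    f y - f x = \int[mu]_(t in `[x, y]) g t.
  move=> x0 xy yl gx gy.
  pose m := Order.min x (l - y).
  have m0 : 0 < m by rewrite lt_min x0/= subr_gt0.
  have := truncnS_gt (l / m); set n := Num.trunc _ => hn.
  have am : a n < m.
    rewrite /a ltr_pdivrMr ?ltr0n// mulrC -ltr_pdivrMr//.
    by apply: lt_le_trans hn _; rewrite ler_nat ltnS; exact: leqW.
  have mx : m <= x by rewrite ge_min lexx.
  have mly : m <= l - y by rewrite ge_min lexx orbT.
  have an := a0 n.
  by apply: (weak_deriv_increment fg _ _ _ _ _ (gx n) (gy n)); lra.
have [m [m0 ml gm]] : exists m, [/\ 0 < m, m < l & good m].
  by apply: ae_itv_exists => //; apply: (ae_imply aegood).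
(* The two branches spell out the oriented integral of g from m to x. *)
pose F x := if m <= x then f m + \int[mu]_(t in `[m, x]) g t
            else f m - \int[mu]_(t in `[x, m]) g t.
exists F.
  split => // x y x0 xy yl; rewrite /F.
  have gxy (s t : R) : 0 < s -> t < l -> mu.-integrable `[s, t] (EFin \o g).
    by move=> ? ?; apply: (L1loc_integrable gl).
  case: (leP m x) => [mx|xm].
    rewrite (le_trans mx xy) (@Rintegral_split _ m y x)//; first by ring.
    exact: gxy.
  case: (leP m y) => [my|ym].
    rewrite (@Rintegral_split _ x y m) ?(ltW xm)//; first by ring.
    exact: gxy.
  rewrite (@Rintegral_split _ x m y)// ?(ltW ym)//; first by ring.
  exact: gxy.
apply: (ae_imply aegood) => x gx /IolP[x0 xl]; rewrite /F.
case: (ltgtP m x) => [mx|xm|<-].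
- by rewrite -incr//; ring.
- by rewrite -incr//; ring.
- by rewrite set_itv1 Rintegral_set1 addr0.
Qed.

End weak_derivative.

(** * Square-integrable functions *)

Section square_integrable.
Context {R : realType}.
Local Notation mu := (@lebesgue_measure R).
Implicit Types (f g h : R -> R) (l : R).

Definition dot l f g : R := \int[mu]_(x in Iol l) (f x * g x).
Definition sqnorm l f : R := \int[mu]_(x in Iol l) (f x ^+ 2).

Lemma integrable_Iol_cst l (c : R) : mu.-integrable (Iol l) (EFin \o (fun=> c)).
Proof.
apply: integrableS (integrable_itv_cst 0 l c) => //; first exact: measurable_Iol.
by apply: subset_itv; rewrite bnd_simp.
Qed.

Lemma integrable_ge0P l h : measurable_fun (Iol l) h -> (forall x, Iol l x -> 0 <= h x) ->
  mu.-integrable (Iol l) (EFin \o h) <-> (\int[mu]_(x in Iol l) (h x)%:E < +oo)%E.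
Proof.
move=> mh h0; have E : (\int[mu]_(x in Iol l) `|(EFin \o h) x| =
    \int[mu]_(x in Iol l) (h x)%:E)%E.
  by apply: eq_integral => x /set_mem xl /=; rewrite ger0_norm// h0.
split; first by move=> /integrableP[_]; rewrite E.
by move=> hoo; apply/integrableP; split; [exact/measurable_EFinP|rewrite E].
Qed.

Lemma isL2_sqr_integrable l f : isL2 l f ->
  mu.-integrable (Iol l) (EFin \o (fun x => f x ^+ 2)).
Proof.
move=> [mf foo]; apply/integrable_ge0P => //; first exact: measurable_funX.
by move=> x _; exact: sqr_ge0.
Qed.

Lemma isL2P l f : measurable_fun (Iol l) f ->
  mu.-integrable (Iol l) (EFin \o (fun x => f x ^+ 2)) -> isL2 l f.
Proof.
move=> mf fi; split => //; apply/integrable_ge0P => //; first exact: measurable_funX.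
by move=> x _; exact: sqr_ge0.
Qed.

Lemma isL2_mul_integrable l f g : isL2 l f -> isL2 l g ->
  mu.-integrable (Iol l) (EFin \o (fun x => f x * g x)).
Proof.
move=> fL gL; have mD := @measurable_Iol R l.
apply: (@integrable_le _ _ _ (fun x => f x ^+ 2 + g x ^+ 2)) => //.
- by apply: measurable_funM; [case: fL|case: gL].
- by move=> x _; rewrite ler_norml; apply/andP; split; nra.
- by apply: integrable_EFinD => //; exact: isL2_sqr_integrable.
Qed.

Lemma isL2_integrable l f : isL2 l f -> mu.-integrable (Iol l) (EFin \o f).
Proof.
move=> fL; have mD := @measurable_Iol R l.
apply: (@integrable_le _ _ _ (fun x => f x ^+ 2 + 1)) => //.
- by case: fL.
- by move=> x _; rewrite ler_norml; apply/andP; split; nra.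
- apply: integrable_EFinD => //; [exact: isL2_sqr_integrable|exact: integrable_Iol_cst].
Qed.

Lemma sqrD_le2 (a b : R) : (a + b) ^+ 2 <= 2 * (a ^+ 2 + b ^+ 2).
Proof. by have := sqr_ge0 (a - b); rewrite !expr2; nra. Qed.

Lemma isL2D l f g : isL2 l f -> isL2 l g -> isL2 l (fun x => f x + g x).
Proof.
move=> fL gL; have mD := @measurable_Iol R l.
have mfg : measurable_fun (Iol l) (fun x => f x + g x).
  by apply: measurable_funD; [case: fL|case: gL].
apply: isL2P => //.
apply: (@integrable_le _ _ _ (fun x => 2 * (f x ^+ 2 + g x ^+ 2))) => //.
- exact: measurable_funX.
- by move=> x _; rewrite ger0_norm ?sqr_ge0 ?sqrD_le2.
- apply: integrable_EFinZ => //; apply: integrable_EFinD => //; exact: isL2_sqr_integrable.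
Qed.

Lemma isL2Z l f (c : R) : isL2 l f -> isL2 l (fun x => c * f x).
Proof.
move=> fL; have mD := @measurable_Iol R l.
apply: isL2P; first by apply: measurable_funM => //; case: fL.
apply: eq_integrable (integrable_EFinZ (c ^+ 2) mD (isL2_sqr_integrable fL)) => //.
by move=> x _ /=; rewrite exprMn.
Qed.

Lemma isL2B l f g : isL2 l f -> isL2 l g -> isL2 l (fun x => f x - g x).
Proof.
move=> fL gL; have := isL2D fL (isL2Z (-1) gL).
by rewrite (_ : (fun x => f x + -1 * g x) = fun x => f x - g x)//; apply/funext => x; rewrite mulN1r.
Qed.

Lemma dotC l f g : dot l f g = dot l g f.
Proof. by apply: eq_Rintegral => x _; rewrite mulrC. Qed.

Lemma dotDl l f g h : isL2 l f -> isL2 l g -> isL2 l h ->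
  dot l (fun x => f x + g x) h = dot l f h + dot l g h.
Proof.
move=> fL gL hL; rewrite /dot -RintegralD//; [|exact: measurable_Iol|exact: isL2_mul_integrable..].
by apply: eq_Rintegral => x _; rewrite mulrDl.
Qed.

Lemma dotZl l f h (c : R) : isL2 l f -> isL2 l h ->
  dot l (fun x => c * f x) h = c * dot l f h.
Proof.
move=> fL hL; rewrite /dot -RintegralZl//; [|exact: measurable_Iol|exact: isL2_mul_integrable].
by apply: eq_Rintegral => x _; rewrite mulrA.
Qed.

Lemma sqnorm_ge0 l f : 0 <= sqnorm l f.
Proof. by apply: Rintegral_ge0 => x _; exact: sqr_ge0. Qed.

Lemma L2dist2E l f g : isL2 l f -> isL2 l g ->
  L2dist2 l f g = (sqnorm l (fun x => f x - g x))%:E.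
Proof.
move=> fL gL; rewrite /L2dist2 /sqnorm /Rintegral fineK//.
apply: integrable_fin_num; first exact: measurable_Iol.
exact: isL2_sqr_integrable (isL2B fL gL).
Qed.

Lemma sqnormD_le l f g : isL2 l f -> isL2 l g ->
  sqnorm l (fun x => f x + g x) <= 2 * sqnorm l f + 2 * sqnorm l g.
Proof.
move=> fL gL; have mD := @measurable_Iol R l.
have fi := isL2_sqr_integrable fL; have gi := isL2_sqr_integrable gL.
rewrite -mulrDr /sqnorm -RintegralD// -RintegralZl//; last exact: integrable_EFinD.
apply: le_Rintegral => //.
- exact: isL2_sqr_integrable (isL2D fL gL).
- by apply: integrable_EFinZ => //; exact: integrable_EFinD.
- by move=> x _; exact: sqrD_le2.
Qed.

(** Takes the place of the Cauchy-Schwarz inequality: the free weight k lets one factor absorb the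
    smallness of the other without square roots. After rescaling it is |s t| <= s^2 + t^2. *)
Lemma dot_young l f g (k : R) : 0 < k -> isL2 l f -> isL2 l g ->
  `|dot l f g| <= k^-1 * sqnorm l f + k * sqnorm l g.
Proof.
move=> k0 fL gL; have mD := @measurable_Iol R l.
have fi := isL2_sqr_integrable fL; have gi := isL2_sqr_integrable gL.
have fgi := isL2_mul_integrable fL gL.
rewrite (le_trans (le_normr_Rintegral _ fgi))//.
rewrite /sqnorm -!RintegralZl// -RintegralD//; [|exact: integrable_EFinZ..].
apply: le_Rintegral => //.
- exact: integrable_norm.
- by apply: integrable_EFinD => //; exact: integrable_EFinZ.
- move=> x _.
  have -> : k^-1 * f x ^+ 2 + k * g x ^+ 2 = k * ((k^-1 * f x) ^+ 2 + g x ^+ 2).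
    by field; rewrite gt_eqF.
  have -> : f x * g x = k * ((k^-1 * f x) * g x) by field; rewrite gt_eqF.
  rewrite normrM gtr0_norm// ler_pM2l//; move: (k^-1 * f x) (g x) => s t.
  by rewrite ler_norml; apply/andP; split; nra.
Qed.

Lemma dot_small l g (e : R) : 0 < e -> isL2 l g ->
  exists2 d : R, 0 < d & forall f, isL2 l f -> sqnorm l f < d -> `|dot l f g| <= e.
Proof.
move=> e0 gL; have N0 := sqnorm_ge0 l g.
(* This weight brings the term in g below e / 2, and the threshold k e / 2 does the same for f; the
   1 covers a vanishing norm of g. *)
pose k := e / (2 * (sqnorm l g + 1)).
have k0 : 0 < k by rewrite divr_gt0//; lra.
exists (k * (e / 2)); first by rewrite mulr_gt0//; lra.
move=> f fL fd; rewrite (le_trans (dot_young k0 fL gL))//.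
have h1 : k^-1 * sqnorm l f <= e / 2 by rewrite mulrC ler_pdivrMr// mulrC ltW.
have h2 : k * sqnorm l g <= e / 2.
  rewrite /k mulrAC ler_pdivrMr; last lra.
  have -> : e / 2 * (2 * (sqnorm l g + 1)) = e * (sqnorm l g + 1) by field.
  by rewrite ler_pM2l//; lra.
lra.
Qed.

(** [isL2] excludes the default value 0 that [fine] assigns to an infinite integral. *)
Lemma sqnorm_eq0 l f : isL2 l f -> sqnorm l f = 0 -> ae_eq_on l f (fun=> 0).
Proof.
move=> fL f0; have mD := @measurable_Iol R l.
have fi := isL2_sqr_integrable fL.
have mf2 : measurable_fun (Iol l) (fun x => f x ^+ 2) by apply: measurable_funX; case: fL.
have E : (\int[mu]_(x in Iol l) `|(f x ^+ 2)%:E| = 0)%E.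
  have -> : (\int[mu]_(x in Iol l) `|(f x ^+ 2)%:E| = \int[mu]_(x in Iol l) (f x ^+ 2)%:E)%E.
    by apply: eq_integral => x _ /=; rewrite ger0_norm// sqr_ge0.
  by rewrite -[LHS]fineK ?[fine _]f0//; exact: integrable_fin_num.
have h : ae_eq mu (Iol l) (fun x => (f x ^+ 2)%:E) (cst 0%E).
  by apply/ae_eq_integral_abs => //; exact/measurable_EFinP.
apply: (ae_imply h) => x hx xl; have /= := hx xl.
by move=> [] /eqP; rewrite sqrf_eq0 => /eqP.
Qed.

Lemma sqnorm_ae0 l f : isL2 l f -> ae_eq_on l f (fun=> 0) -> sqnorm l f = 0.
Proof.
move=> fL f0; have mD := @measurable_Iol R l.
rewrite /sqnorm (@Rintegral_ae_eq _ _ _ (fun=> 0))//.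
- by rewrite Rintegral_cst// mul0r.
- by apply: measurable_funX; case: fL.
- by apply: (ae_imply f0) => x hx xl; rewrite hx// expr0n.
Qed.

(* On [x, 2x] a function above c / t has integral at least c / 2, which contradicts the
   absolute continuity of the integral as x tends to 0. *)
Lemma inv_not_integrable l h (c y : R) : 0 < y -> y <= l -> 0 < c ->
  mu.-integrable (Iol l) (EFin \o h) -> (forall x, Iol l x -> 0 <= h x) ->
  {ae mu, forall x, Iol l x -> x < y -> c / x <= h x} -> False.
Proof.
move=> y0 yl c0 hi h0 hc; have mD := @measurable_Iol R l.
pose k := h \_ (Iol l).
have ki : mu.-integrable setT (EFin \o k).
  by rewrite /k -restrict_EFin; apply/integrable_restrict => //; rewrite setTI.
have c20 : 0 < c / 2 by lra.
have [d [d0 Hd]] := integral_normr_continuous ki c20.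
(* The measure x of [x, 2x] must stay below d, and 2x below y. *)
pose x := Order.min (d / 2) (y / 4).
have x0 : 0 < x by rewrite lt_min; apply/andP; split; lra.
have xd : x <= d / 2 by rewrite ge_min lexx.
have xy : x <= y / 4 by rewrite ge_min lexx orbT.
pose A := `[x, 2 * x]%classic.
have AD : A `<=` Iol l by apply: itv_sub_Iol; lra.
have muA : mu A = x%:E.
  rewrite /A lebesgue_measure_itv/= lte_fin ifT; last lra.
  by rewrite -EFinD; congr EFin; ring.
have H : \int[mu]_(t in A) `|k t| < c / 2.
  apply: Hd; first exact: measurable_itv.
  by apply: (@le_lt_trans _ _ x%:E); [rewrite -muA|rewrite lte_fin; lra].
move: H; apply/negP; rewrite -leNgt.
have kh t : A t -> `|k t| = h t.
  by move=> /AD tD; rewrite /k patchE mem_set// ger0_norm// h0.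
have hiA : mu.-integrable A (EFin \o h) by apply: integrableS hi => //; exact: measurable_itv.
have -> : \int[mu]_(t in A) `|k t| = \int[mu]_(t in A) h t.
  by apply: eq_Rintegral => t /set_mem; exact: kh.
have -> : c / 2 = \int[mu]_(t in A) (c / (2 * x)).
  rewrite Rintegral_cst//= ?muA/=; first by field; rewrite gt_eqF.
  exact: measurable_itv.
rewrite /Rintegral; apply: fine_le.
- by apply: integrable_fin_num; [exact: measurable_itv|exact: integrable_itv_cst].
- by apply: integrable_fin_num => //; exact: measurable_itv.
apply: ae_ge0_le_integral => //.
- exact: measurable_itv.
- by move=> t _; rewrite lee_fin divr_ge0//; lra.
- by move=> t /AD tD; rewrite lee_fin h0.
- by apply/measurable_EFinP; exact: integrable_measurable.
- apply: (ae_imply hc) => t ht At; rewrite lee_fin.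
  have tD := AD _ At; move: At; rewrite /A/= in_itv/= => /andP[xt t2].
  apply: le_trans (ht tD _); last lra.
  by rewrite ler_pM2l// lef_pV2// posrE; lra.
Qed.

End square_integrable.

(** * The degenerate operator *)

Section degenerate_operator.
Context {R : realType}.
Local Notation mu := (@lebesgue_measure R).
Implicit Types (f g h u v w F G U V P Q : R -> R) (l a : R).

(** Every interval around x contains a point where F and G agree, which a gap e at x excludes once
    both vary by at most e / 3. *)
Lemma continuous_ae_eq l F G : {in Iol l, continuous F} -> {in Iol l, continuous G} ->
  ae_eq_on l F G -> forall x, Iol l x -> F x = G x.
Proof.
move=> cF cG FG x xl; apply/eqP; rewrite -subr_eq0 -normr_le0 leNgt; apply/negP.
set e := `|_| => e0; have e30 : 0 < e / 3 by lra.
have /cvgrPdist_le /(_ _ e30) hF := cF x (mem_set xl).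
have /cvgrPdist_le /(_ _ e30) hG := cG x (mem_set xl).
have [x0 xltl] := (IolP l x).1 xl.
have [d /= d0 Hd] : \forall t \near x,
    [/\ `|F x - F t| <= e / 3, `|G x - G t| <= e / 3, 0 < t & t < l].
  near=> t; split; near: t => //; [exact: lt_nbhsr|exact: lt_nbhsl].
have [t [t1 t2 tFG]] : exists t, [/\ x - d < t, t < x + d & F t = G t].
  apply: ae_itv_exists; first lra.
  apply: (ae_imply FG) => t ht t1 t2; apply: ht; apply/IolP.
  have [] := Hd t; last by move=> _ _ t0 tl; split.
  by rewrite /= ltr_norml; apply/andP; split; lra.
have [|h1 h2 _ _] := Hd t; first by rewrite /= ltr_norml; apply/andP; split; lra.
have : e <= `|F x - F t| + `|G x - G t|.
  by rewrite /e [X in _ <= _ + X]distrC -tFG; exact: ler_distD.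
lra.
Unshelve. all: by end_near. Qed.

Lemma primitive_eq l F G f : (forall x, Iol l x -> F x = G x) ->
  primitive_on l F f -> primitive_on l G f.
Proof.
move=> FG [fi Ff]; split => // x y x0 xy yl; rewrite -Ff// !FG//; apply/IolP; split => //.
- exact: le_lt_trans yl.
- exact: lt_le_trans xy.
Qed.

Lemma primitive_weak_deriv_uniq l u U g g' : 0 < l -> primitive_on l U g ->
  ae_eq_on l u U -> weak_deriv l u g' -> ae_eq_on l g g'.
Proof.
move=> l0 Ug uU /(weak_deriv_primitive l0)[U' Ug' uU'].
apply: (primitive_uniq Ug); apply: (primitive_eq _ Ug'); apply: continuous_ae_eq.
- exact: primitive_continuous Ug'.
- exact: primitive_continuous Ug.
- by apply: (ae_imply2 uU uU') => x h1 h2 xl; rewrite -h1// -h2.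
Qed.

Lemma Iol_cvg_left l F (c : R) : 0 < l -> F x @[x --> l^'-] --> c ->
  forall e : R, 0 < e -> exists2 d, 0 < d & forall x, Iol l x -> l - d < x -> `|F x - c| < e.
Proof.
move=> l0 /cvgrPdist_lt Fc e e0; have [d /= d0 Hd] := Fc _ e0.
exists d => // x /IolP[x0 xl] dx; rewrite distrC; apply: Hd => //=.
by rewrite gtr0_norm; lra.
Qed.

Lemma Iol_cvg_right l F (c : R) : 0 < l -> F x @[x --> 0^'+] --> c ->
  forall e : R, 0 < e -> exists2 d, 0 < d & forall x, Iol l x -> x < d -> `|F x - c| < e.
Proof.
move=> l0 /cvgrPdist_lt Fc e e0; have [d /= d0 Hd] := Fc _ e0.
exists d => // x /IolP[x0 xl] dx; rewrite distrC; apply: Hd => //=.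
by rewrite sub0r normrN gtr0_norm.
Qed.

(* The continuous representatives [U] of [u] and [P] of the flux [x^a u'], together
   with what the domain of the operator says about them. *)
Record flux_rep l a u w U P g : Prop := FluxRep {
  rep_primU : primitive_on l U g;
  rep_primP : primitive_on l P w;
  rep_U : ae_eq_on l u U;
  rep_P : ae_eq_on l (fun x => x `^ a * g x) P;
  rep_left : forall e : R, 0 < e ->
    exists2 d : R, 0 < d & forall x, Iol l x -> l - d < x -> `|U x| < e;
  rep_right : a < 1 -> forall e : R, 0 < e ->
    exists2 d : R, 0 < d & forall x, Iol l x -> x < d -> `|U x| < e;
  rep_uL2 : isL2 l u;
  rep_wL2 : isL2 l w;
  rep_energy : mu.-integrable (Iol l) (EFin \o (fun x => x `^ a * g x ^+ 2)) }.

(** [A_op] supplies two weak derivatives of u, one with finite energy and one inside the flux, as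
    well as its own continuous representative. Uniqueness identifies them, so the energy bound
    passes to [g] and the boundary values to [U]. *)
Lemma A_op_flux_rep l a u w : 0 < l -> A_op l a u w -> exists U P g, flux_rep l a u w U P g.
Proof.
move=> l0 [[uL [[g' [ug' g'e]] [uc [cuc uuc ucl uc0]]]] [g [ug _ xgw wL]]].
have [U Ug uU] := weak_deriv_primitive l0 ug.
have [P Pw gP] := weak_deriv_primitive l0 xgw.
have Uuc : forall x, Iol l x -> U x = uc x.
  apply: continuous_ae_eq => //; first exact: primitive_continuous Ug.
  by apply: (ae_imply2 uU uuc) => x h1 h2 xl; rewrite -h1// -h2.
have gg' := primitive_weak_deriv_uniq l0 Ug uU ug'.
have mg : measurable_fun (Iol l) g by case: Ug => -[].
have mg' : measurable_fun (Iol l) g' by case: ug' => _ [[]].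
have mx (h : R -> R) : measurable_fun (Iol l) h ->
    measurable_fun (Iol l) (fun x => x `^ a * h x ^+ 2).
  move=> mh; apply: measurable_funM; last exact: measurable_funX.
  by apply: measurable_funTS; exact: measurable_powR.
have x0 (h : R -> R) x : 0 <= x `^ a * h x ^+ 2.
  by rewrite mulr_ge0 ?powR_ge0 ?sqr_ge0.
exists U, P, g; split => //.
- move=> e e0; have [d d0 Hd] := Iol_cvg_left l0 ucl e0; exists d => // x xl xd.
  by rewrite Uuc// -[uc x]subr0; exact: Hd.
- move=> a1 e e0; have [d d0 Hd] := Iol_cvg_right l0 (uc0 a1) e0; exists d => // x xl xd.
  by rewrite Uuc// -[uc x]subr0; exact: Hd.
- apply/integrable_ge0P => //; first exact: mx.
  rewrite (_ : (\int[mu]_(x in Iol l) _)%E =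
     (\int[mu]_(x in Iol l) (x `^ a * g' x ^+ 2)%:E)%E)//.
  apply: ge0_ae_eq_integral.
  + exact: measurable_Iol.
  + by apply/measurable_EFinP; exact: mx.
  + by apply/measurable_EFinP; exact: mx.
  + by move=> x _; rewrite lee_fin.
  + by move=> x _; rewrite lee_fin.
  + by apply: (ae_imply gg') => x h xl; rewrite h.
Qed.

Lemma Rintegral_subset_ge0 (A B : set R) h : measurable A -> measurable B -> A `<=` B ->
  mu.-integrable B (EFin \o h) -> (forall x, B x -> 0 <= h x) ->
  \int[mu]_(x in A) h x <= \int[mu]_(x in B) h x.
Proof.
move=> mA mB AB hi h0; apply: fine_le.
- by apply: integrable_fin_num => //; apply: integrableS hi.
- by apply: integrable_fin_num.
- apply: ge0_subset_integral => //; apply/measurable_EFinP; exact: integrable_measurable.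
Qed.

Lemma primitive_increment_le l P w (x y : R) : primitive_on l P w ->
  0 < x -> x <= y -> y < l -> `|P y - P x| <= \int[mu]_(t in `[x, y]) `|w t|.
Proof.
move=> [wi Pw] x0 xy yl; rewrite Pw//; apply: le_normr_Rintegral => //.
exact: (L1loc_integrable wi).
Qed.

Lemma primitive_bounded_Iol l P w : 0 < l -> primitive_on l P w ->
  mu.-integrable (Iol l) (EFin \o w) ->
  exists2 C : R, 0 < C & forall x, Iol l x -> `|P x| <= C.
Proof.
move=> l0 Pw wi; pose I := \int[mu]_(t in Iol l) `|w t|.
have le (x y : R) : 0 < x -> x <= y -> y < l -> `|P y - P x| <= I.
  move=> x0 xy yl; apply: le_trans (primitive_increment_le Pw x0 xy yl) _.
  apply: Rintegral_subset_ge0 => //; [exact: measurable_Iol|exact: itv_sub_Iol|].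
  exact: integrable_norm.
have I0 : 0 <= I by apply: Rintegral_ge0.
exists (`|P (l / 2)| + I + 1); first by rewrite ltr_wpDl// addr_ge0.
move=> x /IolP[x0 xl]; move: I I0 le => I I0 le.
have h : `|P x - P (l / 2)| <= I.
  have [h|h] := leP x (l / 2); first by rewrite distrC; apply: le => //; lra.
  by apply: le => //; lra.
have := ler_normD (P x - P (l / 2)) (P (l / 2)); rewrite subrK; lra.
Qed.

(* For a >= 1 the energy bound forces the flux to vanish at 0, and then the
   Cauchy-Schwarz inequality gives its rate. *)
Lemma flux_le_sqrt l a u w U P g : 0 < l -> l <= 1 -> 1 <= a ->
  flux_rep l a u w U P g ->
  exists2 C : R, 0 < C & forall x, Iol l x -> P x ^+ 2 <= C * x.
Proof.
move=> l0 l1 a1 rep.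
have Pw := rep_primP rep; have wL := rep_wL2 rep.
have wi := isL2_integrable wL; have w2i := isL2_sqr_integrable wL.
pose I (y : R) := \int[mu]_(t in `]0, y]) `|w t|.
have sub (y : R) : y < l -> `]0, y] `<=` Iol l.
  move=> yl x /=; rewrite in_itv/= => /andP[x0 xy]; apply/IolP; split => //.
  exact: le_lt_trans yl.
(* Otherwise |P| >= d > 0 on (0, y), and the energy density P^2 / x^a is at least d^2 / x. *)
have step1 (y : R) : Iol l y -> `|P y| <= I y.
  move=> yl; have /IolP[y0 yltl] := yl; rewrite leNgt; apply/negP => lt.
  pose d := `|P y| - I y; have d0 : 0 < d by rewrite subr_gt0.
  have Pd (x : R) : 0 < x -> x < y -> d <= `|P x|.
    move=> x0 xy.
    have h1 := primitive_increment_le Pw x0 (ltW xy) yltl.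
    have h2 : \int[mu]_(t in `[x, y]) `|w t| <= I y.
      apply: Rintegral_subset_ge0 => //.
      - by apply: subset_itvr; rewrite bnd_simp.
      - by apply: integrable_norm; apply: integrableS wi => //; [exact: measurable_Iol|exact: sub].
    have h3 := ler_normD (P y - P x) (P x); rewrite subrK in h3.
    rewrite /d lerBlDr (le_trans h3)// addrC lerD2l; exact: le_trans h2.
  apply: (@inv_not_integrable _ l (fun x => x `^ a * g x ^+ 2) (d ^+ 2) y) => //.
  - exact: ltW.
  - by rewrite exprn_gt0.
  - exact: rep_energy rep.
  - by move=> x _; rewrite mulr_ge0 ?powR_ge0 ?sqr_ge0.
  apply: (ae_imply (rep_P rep)) => x hx xl xy; have /IolP[x0 xltl] := xl.
  have xa0 : 0 < x `^ a by exact: powR_gt0.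
  have -> : x `^ a * g x ^+ 2 = P x ^+ 2 / x `^ a.
    by rewrite -hx// exprMn; field; rewrite gt_eqF.
  have xax : x `^ a <= x by apply: ge1r_powR => //; rewrite x0/=; lra.
  apply: ler_pM => //.
  - exact: sqr_ge0.
  - by rewrite invr_ge0 ltW.
  - by rewrite -[P x ^+ 2]real_normK ?num_real// ler_sqr ?nnegrE ?(ltW d0)// Pd.
  - by rewrite lef_pV2.
(* With s = sqrt y, the pointwise bound |w| <= s w^2 + 1/s integrates over (0, y] to at most s times
   the squared norm of w, plus y / s = s. *)
have step2 (y : R) : Iol l y -> I y <= Num.sqrt y * (sqnorm l w + 1).
  move=> yl; have /IolP[y0 yltl] := yl; pose s := Num.sqrt y.
  have s0 : 0 < s by rewrite sqrtr_gt0.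
  have ss : s ^+ 2 = y by rewrite sqr_sqrtr// ltW.
  have mA : measurable `]0, y] by exact: measurable_itv.
  have w2A : mu.-integrable `]0, y] (EFin \o (fun x => w x ^+ 2)).
    by apply: integrableS w2i => //; [exact: measurable_Iol|exact: sub].
  have cA (c : R) : mu.-integrable `]0, y] (EFin \o (fun=> c)).
    apply: integrableS (integrable_itv_cst 0 y c) => //.
    by apply: subset_itvr; rewrite bnd_simp.
  apply: (@le_trans _ _ (\int[mu]_(t in `]0, y]) (s * w t ^+ 2 + s^-1))).
    apply: le_Rintegral => //.
    - by apply: integrable_norm; apply: integrableS wi => //; [exact: measurable_Iol|exact: sub].
    - by apply: integrable_EFinD => //; exact: integrable_EFinZ.
    - move=> t _; have -> : s * w t ^+ 2 + s^-1 = s^-1 * ((s * w t) ^+ 2 + 1).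
        by field; rewrite gt_eqF.
      have -> : `|w t| = s^-1 * `|s * w t|.
        by rewrite normrM gtr0_norm// mulKf// gt_eqF.
      rewrite ler_pM2l ?invr_gt0//; move: (s * w t) => z.
      by rewrite ler_norml; apply/andP; split; nra.
  rewrite RintegralD//; last exact: integrable_EFinZ.
  rewrite RintegralZl// mulrDr; apply: lerD.
    rewrite ler_pM2l//; apply: Rintegral_subset_ge0 => //; [exact: measurable_Iol|exact: sub|].
    by move=> x _; exact: sqr_ge0.
  rewrite Rintegral_cst//= lebesgue_measure_itv/= lte_fin y0/= subr0 mulr1 -/s.
  by rewrite -ss expr2 mulKf// gt_eqF.
have N0 := sqnorm_ge0 l w.
exists ((sqnorm l w + 1) ^+ 2); first by rewrite exprn_gt0//; lra.
move=> x xl; have /IolP[x0 _] := xl.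
have h := le_trans (step1 x xl) (step2 x xl).
rewrite -[P x ^+ 2]real_normK ?num_real//.
rewrite -[x in leRHS]sqr_sqrtr ?(ltW x0)// -exprMn mulrC.
by rewrite ler_sqr ?nnegrE// mulr_ge0 ?sqrtr_ge0//; lra.
Qed.

(** The difference consists of the integrals over (0, x] and (y, l), each at most e / 2 by absolute
    continuity of the integral. *)
Lemma Rintegral_Iol_tail l h (e : R) : mu.-integrable (Iol l) (EFin \o h) -> 0 < e ->
  exists2 d : R, 0 < d & forall x y : R, 0 < x -> x < d -> l - d < y -> y < l -> x <= y ->
    `|\int[mu]_(t in Iol l) h t - \int[mu]_(t in `[x, y]) h t| <= e.
Proof.
move=> hi e0; have mD := @measurable_Iol R l.
pose k := h \_ (Iol l).
have ki : mu.-integrable setT (EFin \o k).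
  by rewrite /k -restrict_EFin; apply/integrable_restrict => //; rewrite setTI.
have e20 : 0 < e / 2 by lra.
have [d [d0 Hd]] := integral_normr_continuous ki e20.
have small (A : set R) (r : R) : measurable A -> A `<=` Iol l -> mu A = r%:E -> r < d ->
    `|\int[mu]_(t in A) h t| <= e / 2.
  move=> mA AD muA rd; have hA : mu.-integrable A (EFin \o h) by apply: integrableS hi.
  apply: le_trans (le_normr_Rintegral _ hA) _ => //; apply/ltW.
  have := Hd A mA; rewrite [X in (X < _)%E -> _](_ : _ = r%:E)// lte_fin => /(_ rd).
  apply: le_lt_trans; rewrite le_eqVlt; apply/orP; left; apply/eqP.
  by apply: eq_Rintegral => t /set_mem /AD tD; rewrite /k patchE mem_set.
exists d => // x y x0 xd dy yl xy.
have xl : x < l by exact: le_lt_trans yl.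
have y0 : 0 < y by exact: lt_le_trans xy.
have hxl : mu.-integrable `]x, l[ (EFin \o h).
  apply: integrableS hi => //; apply: subset_itvr; rewrite bnd_simp; exact: ltW.
have hxy : mu.-integrable `]x, y] (EFin \o h).
  apply: integrableS hi => // t /=; rewrite in_itv/= => /andP[t1 t2]; apply/IolP.
  by split; [exact: lt_trans t1|exact: le_lt_trans yl].
have E1 := @Rintegral_itvB _ h (BRight 0) (BLeft l) x hi; rewrite !bnd_simp in E1.
have {}E1 := E1 (ltW x0) xl.
have E2 := @Rintegral_itvB _ h (BRight x) (BLeft l) y hxl; rewrite !bnd_simp in E2.
have {}E2 := E2 xy yl.
have E3 := @Rintegral_itv_obnd_cbnd _ x (BRight y) h hxy.
have B1 : `|\int[mu]_(t in `]0, x]) h t| <= e / 2.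
  apply: (small _ x) => //.
    by move=> t /=; rewrite in_itv/= => /andP[t1 t2]; apply/IolP; split => //; exact: le_lt_trans xl.
  by rewrite lebesgue_measure_itv/= lte_fin x0 -EFinD subr0.
have B2 : `|\int[mu]_(t in `]y, l[) h t| <= e / 2.
  apply: (small _ (l - y)) => //.
  - by move=> t /=; rewrite in_itv/= => /andP[t1 t2]; apply/IolP; split => //; exact: lt_trans t1.
  - by rewrite lebesgue_measure_itv/= lte_fin yl -EFinD.
  - by rewrite ltrBlDr addrC -ltrBlDr.
rewrite /Iol; move: E1 E2 E3 B1 B2.
set I1 := \int[mu]_(t in `]0, l[) h t; set I2 := \int[mu]_(t in `]0, x]) h t.
set I3 := \int[mu]_(t in `]x, l[) h t; set I4 := \int[mu]_(t in `]x, y]) h t.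
set I5 := \int[mu]_(t in `]y, l[) h t; set I6 := \int[mu]_(t in `[x, y]) h t.
move: I1 I2 I3 I4 I5 I6 => I1 I2 I3 I4 I5 I6; clear => E1 E2 E3.
have -> : I1 - I6 = I2 + I5 by rewrite -E2 -E3 -E1; ring.
move=> B1 B2; apply: le_trans (ler_normD _ _) _; lra.
Qed.

Lemma integrable_L1loc l h : mu.-integrable (Iol l) (EFin \o h) -> L1loc l h.
Proof.
move=> hi; split; first exact: integrable_measurable.
move=> x y x0 xy yl; apply: integrableS hi => //; first exact: measurable_Iol.
exact: itv_sub_Iol.
Qed.

Lemma norm_le_increment (I w1 w2 e : R) : `|w1| <= e -> `|w2| <= e ->
  `|I - (w2 - w1)| <= e -> `|I| <= e * 3.
Proof.
rewrite !ler_norml => /andP[? ?] /andP[? ?] /andP[? ?].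
by apply/andP; split; lra.
Qed.

(** * Wronskian of two elements of the domain, and symmetry of the operator *)

Section wronskian.
Variables (l a : R) (u wu U P g v wv V Q h : R -> R).
Hypotheses (l0 : 0 < l) (l1 : l <= 1).
Hypotheses (repu : flux_rep l a u wu U P g) (repv : flux_rep l a v wv V Q h).

Let W x := P x * V x - U x * Q x.

(** In the product rule the cross terms P v' and u' Q both equal x^a u' v' almost everywhere and
    cancel. *)
Lemma wronskian_primitive : primitive_on l W (fun x => wu x * v x - u x * wv x).
Proof.
have PV := primitiveM (rep_primP repu) (rep_primU repv).
have UQ := primitiveM (rep_primU repu) (rep_primP repv).
apply: (primitive_ae (primitiveB PV UQ)).
  apply: integrable_L1loc; apply: integrable_EFinB; first exact: measurable_Iol.
  - exact: isL2_mul_integrable (rep_wL2 repu) (rep_uL2 repv).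
  - exact: isL2_mul_integrable (rep_uL2 repu) (rep_wL2 repv).
have h1 := ae_imply2 (rep_U repu) (rep_U repv)
  (fun x hu hv => conj hu hv : (Iol l x -> _) /\ (Iol l x -> _)).
have h2 := ae_imply2 (rep_P repu) (rep_P repv)
  (fun x hu hv => conj hu hv : (Iol l x -> _) /\ (Iol l x -> _)).
apply: (ae_imply2 h1 h2) => x [hU hV] [hP hQ] xl.
by rewrite -hP// -hQ// hU// hV//; ring.
Qed.

(** Fluxes are bounded, being primitives of integrable functions, while U and V tend to 0 at l. *)
Lemma wronskian_small_left (d e : R) : 0 < d -> 0 < e ->
  exists y, [/\ Iol l y, l - d < y & `|W y| <= e].
Proof.
move=> d0 e0.
have [C1 C10 HP] := primitive_bounded_Iol l0 (rep_primP repu) (isL2_integrable (rep_wL2 repu)).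
have [C2 C20 HQ] := primitive_bounded_Iol l0 (rep_primP repv) (isL2_integrable (rep_wL2 repv)).
have [d1 d10 HU] := rep_left repu (divr_gt0 e0 (addr_gt0 C10 C20)).
have [d2 d20 HV] := rep_left repv (divr_gt0 e0 (addr_gt0 C10 C20)).
have [y [y0 yd yd1 yd2 yl]] : exists y : R,
    [/\ 0 < y, l - d < y, l - d1 < y, l - d2 < y & y < l].
  near l^'- => y; exists y; split; near: y.
  - exact: nbhs_left_gt.
  - by apply: nbhs_left_gt; lra.
  - by apply: nbhs_left_gt; lra.
  - by apply: nbhs_left_gt; lra.
  - exact: nbhs_left_lt.
have yI : Iol l y by apply/IolP.
exists y; split => //.
have h1 := HP y yI; have h2 := HQ y yI.
have h3 := ltW (HU y yI yd1); have h4 := ltW (HV y yI yd2).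
rewrite /W (le_trans (ler_normB _ _))// !normrM.
have -> : e = C1 * (e / (C1 + C2)) + (e / (C1 + C2)) * C2.
  by field; rewrite gt_eqF// addr_gt0.
by apply: lerD; apply: ler_pM.
Unshelve. all: by end_near. Qed.

(** For a < 1 the argument at l applies. For a >= 1, P^2 <= C1 x and Q^2 <= C2 x; a Wronskian above
    e near 0 would give e^2 <= C x (u^2 + v^2) almost everywhere there, against the integrability of
    u^2 + v^2. *)
Lemma wronskian_small_right (d e : R) : 0 < d -> 0 < e ->
  exists y, [/\ Iol l y, y < d & `|W y| <= e].
Proof.
move=> d0 e0; have [a1|a1] := ltP a 1.
  have [C1 C10 HP] := primitive_bounded_Iol l0 (rep_primP repu) (isL2_integrable (rep_wL2 repu)).
  have [C2 C20 HQ] := primitive_bounded_Iol l0 (rep_primP repv) (isL2_integrable (rep_wL2 repv)).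
  have [d1 d10 HU] := rep_right repu a1 (divr_gt0 e0 (addr_gt0 C10 C20)).
  have [d2 d20 HV] := rep_right repv a1 (divr_gt0 e0 (addr_gt0 C10 C20)).
  have [y [y0 yd yd1 yd2 yl]] : exists y : R, [/\ 0 < y, y < d, y < d1, y < d2 & y < l].
    near (0 : R)^'+ => y; exists y; split; near: y; try exact: nbhs_right_lt.
    exact: nbhs_right_gt.
  have yI : Iol l y by apply/IolP.
  exists y; split => //.
  have h1 := HP y yI; have h2 := HQ y yI.
  have h3 := ltW (HU y yI yd1); have h4 := ltW (HV y yI yd2).
  rewrite /W (le_trans (ler_normB _ _))// !normrM.
  have -> : e = C1 * (e / (C1 + C2)) + (e / (C1 + C2)) * C2.
    by field; rewrite gt_eqF// addr_gt0.
  by apply: lerD; apply: ler_pM.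
have [C1 C10 HP] := flux_le_sqrt l0 l1 a1 repu.
have [C2 C20 HQ] := flux_le_sqrt l0 l1 a1 repv.
apply: contrapT => nex.
have big (x : R) : Iol l x -> x < d -> e < `|W x|.
  by move=> xl xd; rewrite ltNge; apply/negP => We; apply: nex; exists x.
(* The 2 comes from (s + t)^2 <= 2 (s^2 + t^2); the sum dominates both flux constants. *)
pose C := 2 * (C1 + C2).
have C0 : 0 < C by rewrite /C; lra.
pose y := Order.min d l.
have y0 : 0 < y by rewrite lt_min d0.
have yl : y <= l by rewrite ge_min lexx orbT.
have yd : y <= d by rewrite ge_min lexx.
have mD := @measurable_Iol R l.
apply: (@inv_not_integrable _ l (fun x => u x ^+ 2 + v x ^+ 2) (e ^+ 2 / C) y) => //.
- by rewrite divr_gt0// exprn_gt0.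
- apply: integrable_EFinD => //; apply: isL2_sqr_integrable; [exact: rep_uL2 repu|exact: rep_uL2 repv].
- by move=> x _; rewrite addr_ge0 ?sqr_ge0.
apply: (ae_imply2 (rep_U repu) (rep_U repv)) => x hU hV xl xy.
have /IolP[x0 _] := xl.
rewrite hU// hV// mulrAC ler_pdivrMr// ler_pdivrMr//.
have h1 := HP x xl; have h2 := HQ x xl; have h3 := big x xl (lt_le_trans xy yd).
have h4 : e ^+ 2 <= W x ^+ 2.
  rewrite -[W x ^+ 2]real_normK ?num_real// ler_sqr ?nnegrE ?(ltW e0)//; exact: ltW.
apply: (le_trans h4); rewrite /W.
have h5 := sqrD_le2 (P x * V x) (- (U x * Q x)).
apply: (le_trans h5); rewrite sqrrN !exprMn.
have h6 : P x ^+ 2 * V x ^+ 2 <= C1 * x * V x ^+ 2 by rewrite ler_wpM2r ?sqr_ge0.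
have h7 : U x ^+ 2 * Q x ^+ 2 <= U x ^+ 2 * (C2 * x) by rewrite ler_wpM2l ?sqr_ge0.
have h8 : 0 <= U x ^+ 2 * (C1 * x) by rewrite mulr_ge0 ?sqr_ge0// mulr_ge0// ltW.
have h9 : 0 <= V x ^+ 2 * (C2 * x) by rewrite mulr_ge0 ?sqr_ge0// mulr_ge0// ltW.
have -> : (U x ^+ 2 + V x ^+ 2) * C * x = 2 * (U x ^+ 2 * (C1 * x) + C1 * x * V x ^+ 2 +
    (U x ^+ 2 * (C2 * x) + V x ^+ 2 * (C2 * x))) by rewrite /C; ring.
rewrite ler_pM2l//; apply: lerD.
- by rewrite (le_trans h6)// lerDr.
- by rewrite (le_trans h7)// lerDl.
Unshelve. all: by end_near. Qed.

Lemma flux_rep_symmetric : dot l wu v = dot l u wv.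
Proof.
have mD := @measurable_Iol R l.
have i1 := isL2_mul_integrable (rep_wL2 repu) (rep_uL2 repv).
have i2 := isL2_mul_integrable (rep_uL2 repu) (rep_wL2 repv).
apply/eqP; rewrite -subr_eq0 /dot -RintegralB//.
pose k x := wu x * v x - u x * wv x.
have ki : mu.-integrable (Iol l) (EFin \o k) by exact: integrable_EFinB.
(* Three errors of size e: the tail of the integral and the Wronskian at each end. *)
rewrite -normr_le0; apply: (@le0_of_le_eps _ _ 3) => // e e0.
have [d d0 Hd] := Rintegral_Iol_tail ki e0.
(* Capping at l / 2 places x to the left of y. *)
have d10 : 0 < Order.min d (l / 2) by rewrite lt_min d0 divr_gt0.
have [x [xI]] := wronskian_small_right d10 e0; rewrite lt_min => /andP[xd xl2] Wx.
have [y [yI yd Wy]] := wronskian_small_left d10 e0.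
have /IolP[x0 xl] := xI; have /IolP[y0 yl] := yI.
have m1 : Order.min d (l / 2) <= d by rewrite ge_min lexx.
have m2 : Order.min d (l / 2) <= l / 2 by rewrite ge_min lexx orbT.
have xy : x <= y by lra.
have yd' : l - d < y by lra.
have := Hd x y x0 xd yd' yl xy.
have [_ <-//] := wronskian_primitive.
exact: norm_le_increment.
Qed.

End wronskian.

Lemma A_op_symmetric l a u wu v wv : 0 < l -> l <= 1 ->
  A_op l a u wu -> A_op l a v wv -> dot l wu v = dot l u wv.
Proof.
move=> l0 l1 /(A_op_flux_rep l0)[U [P [g repu]]] /(A_op_flux_rep l0)[V [Q [h repv]]].
exact: (flux_rep_symmetric l0 l1 repu repv).
Qed.

End degenerate_operator.

(** * Vanishing at the observation time *)

Section identification.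
Context {R : realType}.
Local Notation mu := (@lebesgue_measure R).
Implicit Types (f g h u v w F G U V P Q : R -> R) (l a : R).

Lemma powR_lt_exponent (x a b : R) : 0 < x -> x < 1 -> a < b -> x `^ b < x `^ a.
Proof.
move=> x0 x1 ab; have -> : b = a + (b - a) by ring.
rewrite powRD; last by rewrite (gt_eqF x0) implybT.
rewrite gtr_pMr ?powR_gt0//.
have ba : 0 < b - a by rewrite subr_gt0.
have := @gt0_ltr_powR _ _ ba x 1; rewrite powR1; apply => //; rewrite nnegrE ?ler01//.
exact: ltW.
Qed.

Lemma flux_rep_eq0 l a1 a2 u1 w1 U1 P1 g1 u2 w2 U2 P2 g2 : 0 < l -> l <= 1 -> a1 < a2 ->
  flux_rep l a1 u1 w1 U1 P1 g1 -> flux_rep l a2 u2 w2 U2 P2 g2 ->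
  ae_eq_on l g1 g2 -> ae_eq_on l w1 w2 -> ae_eq_on l u1 (fun=> 0).
Proof.
move=> l0 l1 a12 rep1 rep2 g12 w12.
have P12 := primitiveB (rep_primP rep1) (rep_primP rep2).
pose m := l / 2; pose c := P1 m - P2 m.
have P0 : primitive_on l (fun x => P1 x - P2 x) (fun=> 0).
  apply: (primitive_ae P12).
    by apply: integrable_L1loc; exact: integrable_Iol_cst.
  by apply: (ae_imply w12) => x h xl; rewrite h// subrr.
have P12c x : Iol l x -> P1 x - P2 x = c.
  move=> /IolP[x0 xl]; have [_ Pi] := P0; have ml : m < l by rewrite /m; lra.
  have m0 : 0 < m by rewrite /m; lra.
  have [xm|mx] := leP x m.
    have := Pi x m x0 xm ml; rewrite Rintegral_itv_cst// mul0r => /eqP.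
    by rewrite subr_eq0 => /eqP.
  have := Pi m x m0 (ltW mx) xl; rewrite Rintegral_itv_cst ?(ltW mx)// mul0r => /eqP.
  by rewrite subr_eq0 => /eqP.
have xlt x : Iol l x -> 0 < x `^ a1 - x `^ a2.
  by move=> /IolP[x0 xl]; rewrite subr_gt0; apply: powR_lt_exponent => //; lra.
have gc : {ae mu, forall x, Iol l x -> (x `^ a1 - x `^ a2) * g1 x = c}.
  have h := ae_imply2 (rep_P rep1) (rep_P rep2)
    (fun x hu hv => conj hu hv : (Iol l x -> _) /\ (Iol l x -> _)).
  apply: (ae_imply2 h g12) => x [h1 h2] hg xl.
  by rewrite mulrBl [in X in _ - X]hg// h1// h2// P12c.
have Ug := rep_primU rep1; have [gl _] := Ug.
pose I (x y : R) := \int[mu]_(t in `[x, y]) `|g1 t|.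
have absl : L1loc l (fun x => `|g1 x|).
  case: gl => mg gi; split; first exact: measurableT_comp.
  by move=> x y x0 xy yl; apply: integrable_norm; exact: gi.
(* As x^a1 - x^a2 > 0, g1 has the sign of c almost everywhere; this form covers increasing,
   decreasing and constant U1 together. *)
have incr (x y : R) : 0 < x -> x <= y -> y < l -> U1 y - U1 x = Num.sg c * I x y.
  have prim : primitive_on l U1 (fun x => Num.sg c * `|g1 x|).
    apply: (primitive_ae Ug).
      case: absl => mg gi; split; first exact: measurable_funM.
      by move=> s t s0 st tl; apply: integrable_EFinZ => //; exact: gi.
    apply: (ae_imply gc) => t ht tl; rewrite -(ht tl) sgrM gtr0_sg ?xlt// mul1r.
    by rewrite -numEsg.
  move=> x0 xy yl; case: prim => _ ->//; rewrite RintegralZl//.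
  exact: (L1loc_integrable absl).
have I0 (x y : R) : 0 <= I x y by apply: Rintegral_ge0.
have small e : 0 < e -> forall x, Iol l x -> `|U1 x| <= e.
  move=> e0 x xl; have /IolP[x0 xltl] := xl.
  have [d d0 Hd] := rep_left rep1 e0.
  have [y [xy dy yl]] : exists y : R, [/\ x <= y, l - d < y & y < l].
    exists ((Order.max x (l - d) + l) / 2).
    have h1 : x <= Order.max x (l - d) by rewrite le_max lexx.
    have h2 : l - d <= Order.max x (l - d) by rewrite le_max lexx orbT.
    have h3 : Order.max x (l - d) < l by rewrite gt_max xltl/=; lra.
    by split; lra.
  have yI : Iol l y by apply/IolP; split => //; exact: lt_le_trans xy.
  have Uy := Hd y yI dy.
  have [a1lt|a1ge] := ltP a1 1.
    have [d' d'0 Hd'] := rep_right rep1 a1lt e0.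
    have [z [z0 zx zd]] : exists z : R, [/\ 0 < z, z <= x & z < d'].
      exists (Order.min x d' / 2).
      have h1 : Order.min x d' <= x by rewrite ge_min lexx.
      have h2 : Order.min x d' <= d' by rewrite ge_min lexx orbT.
      have h3 : 0 < Order.min x d' by rewrite lt_min x0.
      by split; lra.
    have zI : Iol l z by apply/IolP; split => //; exact: le_lt_trans xltl.
    have Uz := Hd' z zI zd.
    (* Monotonicity squeezes U1(x) between its values at z near 0 and y near l, both below e in
       absolute value. *)
    have i1 := incr z x z0 zx xltl; have i2 := incr x y x0 xy yl.
    have J1 := I0 z x; have J2 := I0 x y.
    move: (I z x) (I x y) i1 i2 J1 J2 => i j i1 i2 J1 J2.
    move: Uy Uz; rewrite ler_norml !ltr_norml => /andP[? ?] /andP[? ?].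
    by case: (sgrP c) i1 i2 => _ i1 i2; apply/andP; split; lra.
  suff c0 : c = 0.
    by have := incr x y x0 xy yl; rewrite c0 sgr0 mul0r => /eqP; rewrite subr_eq0 => /eqP <-; exact: ltW.
  apply/eqP; apply/negPn/negP => cn0.
  apply: (@inv_not_integrable _ l (fun x => x `^ a1 * g1 x ^+ 2) (c ^+ 2) l) => //.
  - by rewrite lt_def sqr_ge0 sqrf_eq0 cn0.
  - exact: rep_energy rep1.
  - by move=> t _; rewrite mulr_ge0 ?powR_ge0 ?sqr_ge0.
  apply: (ae_imply gc) => t ht tl _; have /IolP[t0 tltl] := tl.
  rewrite -(ht tl) exprMn; have := xlt t tl.
  have ta0 : 0 < t `^ a1 by exact: powR_gt0.
  have tb0 : 0 < t `^ a2 by exact: powR_gt0.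
  have tat : t `^ a1 <= t by apply: ge1r_powR => //; rewrite t0/=; lra.
  (* With p = t^a1 and q = t^a2 the goal reduces to (p - q)^2 <= p t, true because p - q <= p <=
     t. *)
  move: (t `^ a1) (t `^ a2) ta0 tb0 tat => p q p0 q0 pt pq.
  rewrite mulrAC ler_wpM2r ?sqr_ge0// ler_pdivrMr// expr2.
  by apply: ler_pM; lra.
apply: (ae_imply (rep_U rep1)) => x h xl; rewrite h//.
apply/eqP; rewrite -normr_le0; apply: (@le0_of_le_eps _ _ 1) => // e e0.
by rewrite mulr1 small.
Qed.

Lemma isL2_quotient l f g (h : R) : isL2 l f -> isL2 l g -> isL2 l (fun x => (f x - g x) / h).
Proof.
move=> fL gL; have := isL2Z h^-1 (isL2B fL gL).
by rewrite (_ : (fun x => h^-1 * _) = fun x => (f x - g x) / h)//; apply/funext => x; rewrite mulrC.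
Qed.

Lemma time_deriv_uniq l (T : R) (u : R -> R -> R) (t : R) v w : 0 < t -> t <= T ->
  (forall s : R, 0 < s -> s <= T -> isL2 l (u s)) ->
  time_deriv l T u t v -> time_deriv l T u t w -> ae_eq_on l v w.
Proof.
move=> t0 tT uL [vL Hv] [wL Hw].
have vwL := isL2B vL wL.
suff N0 : sqnorm l (fun x => v x - w x) <= 0.
  have /sqnorm_eq0 : sqnorm l (fun x => v x - w x) = 0.
    by apply/eqP; rewrite eq_le N0 sqnorm_ge0.
  move=> /(_ vwL) h; apply: (ae_imply h) => x /[apply] /eqP.
  by rewrite subr_eq0 => /eqP.
(* Both derivatives are within e of one quotient in squared norm, and 2e + 2e bounds their
   distance. *)
apply: (@le0_of_le_eps _ _ 4) => // e e0.
have [d1 d10 H1] := Hv e e0; have [d2 d20 H2] := Hw e e0.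
(* A negative increment is admissible even at t = T; its size stays below t so that t + h > 0. *)
pose h := - (Order.min (Order.min d1 d2) t / 2).
have m1 : Order.min (Order.min d1 d2) t <= d1 by rewrite !ge_min lexx.
have m2 : Order.min (Order.min d1 d2) t <= d2 by rewrite !ge_min lexx orbT.
have m3 : Order.min (Order.min d1 d2) t <= t by rewrite !ge_min lexx orbT.
have m0 : 0 < Order.min (Order.min d1 d2) t by rewrite !lt_min d10 d20.
have h0 : h != 0 by rewrite oppr_eq0 gt_eqF//; lra.
have hn : `|h| = Order.min (Order.min d1 d2) t / 2 by rewrite normrN gtr0_norm//; lra.
have th0 : 0 < t + h by rewrite /h; lra.
have thT : t + h <= T by rewrite /h; lra.
have qL := isL2_quotient h (uL _ th0 thT) (uL _ t0 tT).
set q := (fun x => _ / h) in qL.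
have {}H1 : sqnorm l (fun x => q x - v x) < e.
  by rewrite -lte_fin -L2dist2E//; apply: H1 => //; lra.
have {}H2 : sqnorm l (fun x => q x - w x) < e.
  by rewrite -lte_fin -L2dist2E//; apply: H2 => //; lra.
have := sqnormD_le (isL2B qL wL) (isL2Z (-1) (isL2B qL vL)).
have -> : sqnorm l (fun x => -1 * (q x - v x)) = sqnorm l (fun x => q x - v x).
  by apply: eq_Rintegral => x _; rewrite mulN1r sqrrN.
have -> : sqnorm l (fun x => q x - w x + -1 * (q x - v x)) = sqnorm l (fun x => v x - w x).
  by apply: eq_Rintegral => x _; congr (_ ^+ 2); ring.
lra.
Qed.

Lemma dot_expand l f g F G (h k : R) : isL2 l f -> isL2 l g -> isL2 l F -> isL2 l G ->
  dot l (fun x => f x + h * F x) (fun x => g x + k * G x) =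
  dot l f g + h * dot l F g + k * dot l f G + h * k * dot l F G.
Proof.
move=> fL gL FL GL; have hF := isL2Z h FL; have kG := isL2Z k GL.
rewrite dotDl//; last exact: isL2D.
rewrite dotZl//; last exact: isL2D.
rewrite !(dotC l _ (fun x => g x + k * G x)) !dotDl// !dotZl//.
by rewrite !(dotC l g) !(dotC l G); ring.
Qed.

End identification.

(** * Backward uniqueness *)

Section backward_uniqueness.
Context {R : realType}.
Implicit Types (f g v w : R -> R) (l a T : R) (u : R -> R -> R).

Lemma solution_isL2 l T a (u0 : R -> R) (u : R -> R -> R) (t : R) :
  is_solution l T a u0 u -> 0 < t -> t <= T -> isL2 l (u t).
Proof. by move=> [sol _] t0 tT; have [w [[[uL _] _] _]] := sol t t0 tT. Qed.

(** Arithmetic of [pairing_local]: A and B are the errors of the two difference quotients against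
    the other factor, and C is the product of the quotients. *)
Lemma pairing_increment_le (h A B C e K : R) : `|A| <= e / 4 -> `|B| <= e / 4 ->
  `|C| <= K -> 0 <= K -> `|h| <= e / (4 * (K + 1)) -> 0 < e ->
  `|h * (A - B - h * C)| <= e * `|h|.
Proof.
move=> hA hB hC K0 hh e0; rewrite normrM mulrC ler_wpM2r//.
have hc : `|h * C| <= e / 4.
  rewrite normrM; apply: (@le_trans _ _ (e / (4 * (K + 1)) * (K + 1))).
    by apply: ler_pM => //; lra.
  have -> : e / (4 * (K + 1)) * (K + 1) = e / 4 by field; apply/eqP; lra.
  by [].
move: hA hB hc; rewrite !ler_norml => /andP[? ?] /andP[? ?] /andP[? ?].
by apply/andP; split; lra.
Qed.

(** One time moves forward and the other backward, so the first-order terms h <A u(s1), u(s2)> and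
    -h <u(s1), A u(s2)> cancel by symmetry. What remains is h times quotient errors and h^2 times a
    bounded pairing. *)
Lemma pairing_local l T a (u0 : R -> R) (u : R -> R -> R) (s1 s2 e : R) :
  0 < l -> l <= 1 -> is_solution l T a u0 u -> 0 < s1 -> s1 <= T -> 0 < s2 -> s2 <= T -> 0 < e ->
  exists2 d : R, 0 < d & forall h : R, `|h| < d ->
    0 < s1 + h -> s1 + h <= T -> 0 < s2 - h -> s2 - h <= T ->
    `|dot l (u (s1 + h)) (u (s2 - h)) - dot l (u s1) (u s2)| <= e * `|h|.
Proof.
move=> l0 l1 sol s10 s1T s20 s2T e0.
have uL (s : R) : 0 < s -> s <= T -> isL2 l (u s) by exact: (solution_isL2 sol).
have [w1 [A1 [w1L D1]]] := sol.1 s1 s10 s1T.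
have [w2 [A2 [w2L D2]]] := sol.1 s2 s20 s2T.
have sym := A_op_symmetric l0 l1 A1 A2.
have u1L := uL _ s10 s1T; have u2L := uL _ s20 s2T.
have e40 : 0 < e / 4 by lra.
have [n1 n10 H1] := dot_small e40 u2L; have [n2 n20 H2] := dot_small e40 u1L.
(* The cap 1 bounds each quotient in squared norm by 2 (1 + |w|^2), whence the constant [K]
   below. *)
pose n := Order.min (Order.min n1 n2) 1.
have nn1 : n <= n1 by rewrite !ge_min lexx.
have nn2 : n <= n2 by rewrite !ge_min lexx orbT.
have nn3 : n <= 1 by rewrite !ge_min lexx orbT.
have n0 : 0 < n by rewrite !lt_min n10 n20/= ltr01.
have [d1 d10 Hd1] := D1 n n0; have [d2 d20 Hd2] := D2 n n0.
have N1 := sqnorm_ge0 l w1; have N2 := sqnorm_ge0 l w2.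
pose K := 2 * (1 + sqnorm l w1) + 2 * (1 + sqnorm l w2).
have K0 : 0 <= K by rewrite /K; lra.
have eK0 : 0 < e / (4 * (K + 1)) by rewrite divr_gt0//; lra.
exists (Order.min (Order.min d1 d2) (e / (4 * (K + 1)))); first by rewrite !lt_min d10 d20 eK0.
move=> h; rewrite !lt_min => /andP[/andP[hd1 hd2] /ltW heK] sh0 shT s2h0 s2hT.
have [->|hn0] := eqVneq h 0; first by rewrite addr0 subr0 subrr normr0 mulr0.
have nh0 : - h != 0 by rewrite oppr_eq0.
have q1L := isL2_quotient h (uL _ sh0 shT) u1L.
have q2L := isL2_quotient (- h) (uL _ s2h0 s2hT) u2L.
have := Hd1 h hn0 hd1 sh0 shT; have := Hd2 (- h) nh0.
rewrite normrN => /(_ hd2 s2h0 s2hT); rewrite !L2dist2E// !lte_fin.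
set q1 := (fun x => _ / h) in q1L *; set q2 := (fun x => _ / - h) in q2L *.
move=> r2 r1.
have r1L := isL2B q1L w1L; have r2L := isL2B q2L w2L.
have E1 : u (s1 + h) = (fun x => u s1 x + h * q1 x).
  by apply/funext => x; rewrite /q1; field.
have E2 : u (s2 - h) = (fun x => u s2 x + (- h) * q2 x).
  by apply/funext => x; rewrite /q2; field.
rewrite E1 E2 dot_expand//.
have F1 : dot l q1 (u s2) = dot l w1 (u s2) + dot l (fun x => q1 x - w1 x) (u s2).
  by rewrite -dotDl//; apply: eq_Rintegral => x _; congr (_ * _); ring.
have F2 : dot l (u s1) q2 = dot l (u s1) w2 + dot l (u s1) (fun x => q2 x - w2 x).
  rewrite !(dotC l (u s1)) -dotDl//; apply: eq_Rintegral => x _; congr (_ * _); ring.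
have -> : dot l (u s1) (u s2) + h * dot l q1 (u s2) + - h * dot l (u s1) q2 +
    h * - h * dot l q1 q2 - dot l (u s1) (u s2) =
    h * (dot l (fun x => q1 x - w1 x) (u s2) - dot l (u s1) (fun x => q2 x - w2 x) -
         h * dot l q1 q2).
  by rewrite F1 F2 sym; ring.
have sq q w : isL2 l q -> isL2 l w -> sqnorm l (fun x => q x - w x) < n ->
    sqnorm l q <= 2 * (1 + sqnorm l w).
  move=> qL wL lt; have := sqnormD_le (isL2B qL wL) wL.
  have -> : sqnorm l (fun x => q x - w x + w x) = sqnorm l q.
    by apply: eq_Rintegral => x _; rewrite subrK.
  by move=> h1; apply: (le_trans h1); lra.
apply: (@pairing_increment_le _ _ _ _ _ K) => //.
- by apply: H1 => //; exact: lt_le_trans nn1.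
- by rewrite dotC; apply: H2 => //; exact: lt_le_trans nn2.
- apply: (le_trans (dot_young ltr01 q1L q2L)); rewrite invr1 !mul1r /K.
  by apply: lerD; [exact: sq q1L w1L r1|exact: sq q2L w2L r2].
Qed.

(* By symmetry of the operator the pairing <u(t), u(r + s - t)> has zero derivative in t,
   so its values at the midpoint and at the endpoint agree. *)
Lemma pairing_midpoint l T a (u0 : R -> R) (u : R -> R -> R) (r s : R) :
  0 < l -> l <= 1 -> is_solution l T a u0 u -> 0 < r -> r <= s -> s <= T ->
  dot l (u ((r + s) / 2)) (u ((r + s) / 2)) = dot l (u s) (u r).
Proof.
move=> l0 l1 sol r0 rs sT; pose m := (r + s) / 2.
pose phi (t : R) := dot l (u t) (u (r + s - t)).
have -> : dot l (u ((r + s) / 2)) (u ((r + s) / 2)) = phi m.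
  by rewrite /phi /m; congr (dot _ _ (u _)); field.
have -> : dot l (u s) (u r) = phi s by rewrite /phi addrK.
have ms : m <= s by rewrite /m; lra.
have rm : r <= m by rewrite /m; lra.
apply/esym/eqP; rewrite -subr_eq0 -normr_le0.
have sm0 : 0 <= s - m by lra.
apply: (le0_of_le_eps sm0) => e e0; rewrite mulrBr.
apply: (@increment_le_of_local _ phi (fun t => e * t)) => //.
  by move=> x y _ xy _; rewrite ler_pM2l.
move=> t mt ts.
have t0 : 0 < t by lra.
have tT : t <= T by lra.
have t20 : 0 < r + s - t by lra.
have t2T : r + s - t <= T by lra.
have [d d0 Hd] := pairing_local l0 l1 sol t0 tT t20 t2T e0.
exists d => // y my ys yd.
have := Hd (y - t) yd.
have -> : t + (y - t) = y by ring.
have -> : r + s - t - (y - t) = r + s - y by ring.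
rewrite -mulrBr normrM (gtr0_norm e0); apply; lra.
Qed.

Lemma solution_backward_unique l T a (u0 : R -> R) (u : R -> R -> R) (t0 : R) :
  0 < l -> l <= 1 -> isL2 l u0 -> is_solution l T a u0 u -> 0 < t0 -> t0 <= T -> ae_eq_on l (u t0) (fun=> 0) ->
  ae_eq_on l u0 (fun=> 0).
Proof.
move=> l0 l1 u0L sol t00 t0T ut0.
have uL (s : R) : 0 < s -> s <= T -> isL2 l (u s) by exact: (solution_isL2 sol).
have dotE f : dot l f f = sqnorm l f by apply: eq_Rintegral => x _; rewrite expr2.
(* The midpoint identity with r = s / 2: the midpoint of s / 2 and s is 3s / 4, and the ratio 3 / 4
   < 1 sends the times to 0. *)
have step (s : R) : 0 < s -> s <= T -> sqnorm l (u s) = 0 -> sqnorm l (u (s * (3 / 4))) = 0.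
  move=> s0 sT us0; have s20 : 0 < s / 2 by lra.
  have s2s : s / 2 <= s by lra.
  have := pairing_midpoint l0 l1 sol s20 s2s sT.
  have -> : (s / 2 + s) / 2 = s * (3 / 4) by field.
  rewrite dotE => ->; apply/eqP; rewrite -normr_le0.
  have s2T : s / 2 <= T by lra.
  apply: (le0_of_le_eps (sqnorm_ge0 l (u (s / 2)))) => e e0.
  have := dot_young e0 (uL _ s0 sT) (uL _ s20 s2T).
  by rewrite us0 mulr0 add0r.
pose sq (n : nat) : R := t0 * (3 / 4) ^+ n.
have q01 : 0 < 3 / 4 :> R by lra.
have sqn n : [/\ 0 < sq n, sq n <= T & sqnorm l (u (sq n)) = 0].
  elim: n => [|n [p0 pT pz]]; last first.
    have -> : sq n.+1 = sq n * (3 / 4) by rewrite /sq exprSr; ring.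
    by split; [rewrite mulr_gt0|lra|exact: step].
  by rewrite /sq expr0 mulr1; split => //; exact: sqnorm_ae0 (uL _ t00 t0T) ut0.
apply: sqnorm_eq0 => //; apply/eqP; rewrite eq_le sqnorm_ge0 andbT.
(* u vanishes in norm at the chosen time, so the squared norm of u0 is at most twice the squared
   distance from u0 to u there. *)
apply: (@le0_of_le_eps _ _ 2) => // e e0.
have [d d0 Hd] := sol.2 e e0.
have [n sqd] : exists n, sq n < d.
  have c : sq n @[n --> \oo] --> (0 : R).
    rewrite -(mulr0 t0); apply: cvgM; first exact: cvg_cst.
    by apply: cvg_expr; rewrite gtr0_norm//; lra.
  have /cvgrPdist_lt /(_ _ d0)[n _ Hn] := c.
  exists n; have := Hn n (leqnn n); rewrite /= sub0r normrN; apply: le_lt_trans.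
  exact: ler_norm.
have [p0 pT pz] := sqn n; have usL := uL _ p0 pT.
have := Hd _ p0 sqd pT; rewrite L2dist2E// lte_fin => lt.
have := sqnormD_le (isL2Z (-1) (isL2B usL u0L)) usL.
rewrite pz mulr0 addr0.
have -> : sqnorm l (fun x => -1 * (u (sq n) x - u0 x)) = sqnorm l (fun x => u (sq n) x - u0 x).
  by apply: eq_Rintegral => x _; rewrite mulN1r sqrrN.
have -> : sqnorm l (fun x => -1 * (u (sq n) x - u0 x) + u (sq n) x) = sqnorm l u0.
  by apply: eq_Rintegral => x _; congr (_ ^+ 2); ring.
by move=> h; apply: (le_trans h); lra.
Qed.

End backward_uniqueness.

(** Uniqueness of time and weak derivatives turns the given v and g into A u and the density of the
    continuous representative, so the hypotheses become those of [flux_rep_eq0]. Exchanging the two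
    solutions excludes the other strict inequality. *)
Lemma equal_derivatives_not_lt (R : realType) (l T : R) (u0 : R -> R) (a1 a2 : R)
  (u1 u2 : R -> R -> R) (t0 : R) (v1 v2 g1 g2 : R -> R) :
  0 < l -> l <= 1 -> isL2 l u0 -> ~ ae_eq_on l u0 (fun _ => 0) ->
  is_solution l T a1 u0 u1 -> is_solution l T a2 u0 u2 ->
  0 < t0 -> t0 <= T ->
  time_deriv l T u1 t0 v1 -> time_deriv l T u2 t0 v2 -> ae_eq_on l v1 v2 ->
  weak_deriv l (u1 t0) g1 -> weak_deriv l (u2 t0) g2 -> ae_eq_on l g1 g2 ->
  ~ a1 < a2.
Proof.
move=> l0 l1 u0L u0n0 sol1 sol2 t00 t0T dv1 dv2 v12 wg1 wg2 g12 a12.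
have [w1 [A1 dw1]] := sol1.1 t0 t00 t0T.
have [w2 [A2 dw2]] := sol2.1 t0 t00 t0T.
have vw1 := time_deriv_uniq t00 t0T (fun s s0 sT => solution_isL2 sol1 s0 sT) dv1 dw1.
have vw2 := time_deriv_uniq t00 t0T (fun s s0 sT => solution_isL2 sol2 s0 sT) dv2 dw2.
have [U1 [P1 [k1 rep1]]] := A_op_flux_rep l0 A1.
have [U2 [P2 [k2 rep2]]] := A_op_flux_rep l0 A2.
have kg1 := primitive_weak_deriv_uniq l0 (rep_primU rep1) (rep_U rep1) wg1.
have kg2 := primitive_weak_deriv_uniq l0 (rep_primU rep2) (rep_U rep2) wg2.
have kk : ae_eq_on l k1 g2.
  by apply: (ae_imply2 kg1 g12) => x h1 h2 xl; rewrite h1// h2.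
have {}kk : ae_eq_on l k1 k2.
  by apply: (ae_imply2 kk kg2) => x h1 h2 xl; rewrite h1// h2.
have ww : ae_eq_on l w1 v2.
  by apply: (ae_imply2 vw1 v12) => x h1 h2 xl; rewrite -h1// h2.
have {}ww : ae_eq_on l w1 w2.
  by apply: (ae_imply2 ww vw2) => x h1 h2 xl; rewrite h1// h2.
apply: u0n0; apply: (solution_backward_unique l0 l1 u0L sol1 t00 t0T).
exact: (flux_rep_eq0 l0 l1 a12 rep1 rep2 kk ww).
Qed.

Theorem theorem3p5 (R : realType) (l T : R) (u0 : R -> R) (a1 a2 : R)
  (u1 u2 : R -> R -> R) (t0 : R) (v1 v2 g1 g2 : R -> R) :
  0 < l -> l <= 1 -> 0 < T ->
  isL2 l u0 -> ~ ae_eq_on l u0 (fun _ => 0) ->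
  0 <= a1 -> a1 < 2 -> 0 <= a2 -> a2 < 2 ->
  is_solution l T a1 u0 u1 -> is_solution l T a2 u0 u2 ->
  0 < t0 -> t0 <= T ->
  time_deriv l T u1 t0 v1 -> time_deriv l T u2 t0 v2 -> ae_eq_on l v1 v2 ->
  weak_deriv l (u1 t0) g1 -> weak_deriv l (u2 t0) g2 -> ae_eq_on l g1 g2 ->
  a1 = a2.
Proof.
move=> l0 l1 _ u0L u0n0 _ _ _ _ sol1 sol2 t00 t0T dv1 dv2 v12 wg1 wg2 g12.
have v21 : ae_eq_on l v2 v1 by apply: (ae_imply v12) => x h xl; rewrite h.
have g21 : ae_eq_on l g2 g1 by apply: (ae_imply g12) => x h xl; rewrite h.
have n12 := equal_derivatives_not_lt l0 l1 u0L u0n0 sol1 sol2 t00 t0T dv1 dv2 v12 wg1 wg2 g12.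
have n21 := equal_derivatives_not_lt l0 l1 u0L u0n0 sol2 sol1 t00 t0T dv2 dv1 v21 wg2 wg1 g21.
by case: (ltgtP a1 a2).
Qed.
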